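(* Let $f$ be the hidden signal and $f_j$ $(1\le j\le M)$ the noiseless, randomly translated and dilated observations of $f$ described in the context. Put $\tilde g_\eta=\frac1M\sum_{j=1}^M Bf_j$ and define the estimator $$(\widetilde{Bf})(r,\theta)=(I-L_{C_0})^{-1}\,C_1\,L_{C_2}\left(4\tilde g_\eta(r,\theta)+r\,\frac{\partial\tilde g_\eta}{\partial r}(r,\theta)\right).$$ Assume that $Bf\in C^3(\mathbb{R}^2)$ and $\overline{(Bf)}^{k}\in L^2(\mathbb{R}^2)$ for $k=2,3$. Then there exist an absolute constant $C>0$ and a constant $K_f$ depending only on $f$ such that $$\mathbb{E}\left[\|Bf-\widetilde{Bf}\|_2^2\right]\le C\left(\frac{\eta^2}{M}\|Bf\|_2^2+\frac{\eta^2}{M}\|r\,\partial_r(Bf)(r,\theta)\|_2^2+\frac{\eta^2}{M}\|r^2\,\partial_{rr}(Bf)(r,\theta)\|_2^2\right)+K_f\,\frac{\eta^4}{M}.$$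
   Context: **Model (noiseless dilation multi-reference alignment).** $f\in L^2(\mathbb{R})$ is a real-valued function and one has $M$ independent observations $$f_j(x)=f\big((1-\tau_j)^{-1}(x-t_j)\big),\qquad 1\le j\le M,$$ where: (i) $\mathrm{supp}(f_j)\subset[-\tfrac12,\tfrac12]$ for all $j$; (ii) $\{t_j\}_{j=1}^M$ are independent samples of a real random variable $t$; (iii) $\{\tau_j\}_{j=1}^M$ are independent samples of a uniformly distributed real random variable $\tau$ with $\mathbb{E}[\tau]=0$ and $\mathrm{Var}(\tau)=\eta^2\le\tfrac1{12}$, $\eta>0$ (so $\tau$ is uniform on $[-\sqrt3\eta,\sqrt3\eta]\subset[-\tfrac12,\tfrac12]$). **Bispectrum.** $\hat f(\omega)=\int_{\mathbb{R}}f(x)e^{-i\omega x}\,dx$, and $Bf(\omega_1,\omega_2)=\hat f(\omega_1)\,\hat f^{*}(\omega_2)\,\hat f(\omega_2-\omega_1)$, where $^*$ denotes complex conjugation; $Bf_j$ is defined in the same way from $f_j$. **Constants and operators.** $$C_0=\frac{1-\sqrt3\eta}{1+\sqrt3\eta},\qquad C_1=2\sqrt3\,\eta,\qquad C_2=\frac1{1+\sqrt3\eta}.$$ For $C>0$, $L_Cg(\omega_1,\omega_2)=C^4g(C\omega_1,C\omega_2)$; in polar coordinates, $L_Cg(r,\theta)=C^4g(Cr,\theta)$. $I$ is the identity. For a locally bounded $h:\mathbb{R}^2\to\mathbb{C}$, $(I-L_{C_0})^{-1}h$ denotes the unique locally bounded $u:\mathbb{R}^2\to\mathbb{C}$ with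 $u-L_{C_0}u=h$ (note $0<C_0<1$). Functions of $(\omega_1,\omega_2)\in\mathbb{R}^2$ are also written in polar coordinates $(r,\theta)$, with $\omega_1=r\cos\theta$, $\omega_2=r\sin\theta$, $r\ge0$. For an integer $k$, $$\overline{(Bf)}^{k}(r,\theta)=r^k\max_{\alpha\in[r/2,2r]}\left|\partial_\alpha^k(Bf)(\alpha,\theta)\right|.$$ $\|\cdot\|_2$ is the norm of $L^2(\mathbb{R}^2)$ on the frequency plane. The expectation is over the random $(t_j,\tau_j)_{j=1}^M$. *)

(* Defs.v *)
(* Library: MathComp-Analysis, over an arbitrary R : realType; complex numbers
   are R[i] from mathcomp-real-closed. *)
From mathcomp Require Import all_boot all_order all_algebra.
From mathcomp Require Import complex.
From mathcomp Require Import all_classical all_reals all_analysis.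

Set Implicit Arguments.
Unset Strict Implicit.
Unset Printing Implicit Defensive.

Import Order.TTheory GRing.Theory Num.Theory.
Import numFieldNormedType.Exports.

Local Open Scope classical_set_scope.
Local Open Scope ring_scope.
Local Open Scope complex_scope.

Section Signals.
Context {R : realType}.
Local Notation mu := (@lebesgue_measure R).

(* The support of an element of L^2(R), i.e. of a function determined only up to
   null sets: the complement of the largest open set on which it vanishes almost
   everywhere. *)
Definition ess_support (g : R -> R) : set R :=
  ~` \bigcup_(U in [set U : set R |
        open U /\ {ae mu, forall x, U x -> g x = 0}]) U.

Definition observation (f : R -> R) (t tau : R) : R -> R :=
  fun x => f ((1 - tau)^-1 * (x - t)).

Definition cis (y : R) : R[i] := cos y +i* sin y.

Definition Cintegral (g : R -> R[i]) : R[i] :=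
  Rintegral mu setT (fun x => complex.Re (g x)) +i* Rintegral mu setT (fun x => complex.Im (g x)).

Definition fourier (f : R -> R) (w : R) : R[i] :=
  Cintegral (fun x => (f x)%:C * cis (- (w * x))).

Definition bispectrum (f : R -> R) : R * R -> R[i] := fun w =>
  fourier f w.1 * (fourier f w.2)^* * fourier f (w.2 - w.1).

End Signals.

Section FrequencyPlane.
Context {R : realType}.
Local Notation mu2 := (@lebesgue_measure R \x @lebesgue_measure R)%E.
Implicit Types g h u : R * R -> R[i].

Fixpoint Ck (k : nat) (g : R * R -> R) : Prop :=
  continuous g /\
  if k is k'.+1 then
    [/\ forall w, derivable g w (1, 0), forall w, derivable g w (0, 1),
        Ck k' (fun w => 'D_(1, 0) g w) & Ck k' (fun w => 'D_(0, 1) g w)]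
  else True.

Definition complex_Ck k g : Prop :=
  Ck k (fun w => complex.Re (g w)) /\ Ck k (fun w => complex.Im (g w)).

Definition L2norm g : \bar R :=
  Lnorm mu2 2%:E (fun w => (Normc.normc (g w))%:E).

Definition radius (w : R * R) : R := Num.sqrt (w.1 ^+ 2 + w.2 ^+ 2).

(* Valued in ]-pi, pi]; at the origin, where the angle is not determined, the
   value is pi / 2. *)
Definition angle (w : R * R) : R :=
  if 0 <= w.2 then acos (w.1 / radius w) else - acos (w.1 / radius w).

Definition to_polar g : R -> R -> R[i] :=
  fun r theta => g (r * cos theta, r * sin theta).

Definition of_polar {T : Type} (h : R -> R -> T) : R * R -> T :=
  fun w => h (radius w) (angle w).

(* The k-th partial derivative in r of g(r, theta). The ray is extended to a
   line, so this is a two-sided derivative at r = 0 as well. *)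
Definition radial_derive (k : nat) g (r theta : R) : R[i] :=
  derive1n k (fun s => complex.Re (to_polar g s theta)) r +i*
  derive1n k (fun s => complex.Im (to_polar g s theta)) r.

Definition r_radial_derive (k : nat) g : R * R -> R[i] :=
  of_polar (fun r theta => (r ^+ k)%:C * radial_derive k g r theta).

(* The supremum is a maximum as soon as g is of class C^k. *)
Definition radial_max (k : nat) g : R * R -> R :=
  of_polar (fun r theta => r ^+ k *
    sup [set Normc.normc (radial_derive k g alpha theta) |
         alpha in `[r / 2, 2 * r]]).

Definition dilation (C : R) g : R * R -> R[i] :=
  fun w => (C ^+ 4)%:C * g (C * w.1, C * w.2).

Definition locally_bounded g : Prop :=
  forall w0 : R * R, exists B : R, \forall w \near w0, Normc.normc (g w) <= B.

(* (I - L_C)^{-1} h. For 0 < C < 1 and h locally bounded, the set below is a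
   singleton; its element is the sum over n of L_C^n h. *)
Definition inv_sub_dilation (C : R) h : R * R -> R[i] :=
  xget (fun=> 0)
    [set u | locally_bounded u /\ forall w, u w - dilation C u w = h w].

End FrequencyPlane.

Section Estimator.
Context {R : realType}.
Variable eta : R.

Definition C0 : R := (1 - Num.sqrt 3 * eta) / (1 + Num.sqrt 3 * eta).
Definition C1 : R := 2 * Num.sqrt 3 * eta.
Definition C2 : R := (1 + Num.sqrt 3 * eta)^-1.

Definition mean_bispectrum (M : nat) (fs : 'I_M -> R -> R) : R * R -> R[i] :=
  fun w => (M%:R)^-1 * \sum_(j < M) bispectrum (fs j) w.

Definition bispectrum_estimator (M : nat) (fs : 'I_M -> R -> R) :
    R * R -> R[i] :=
  let g := mean_bispectrum fs in
  inv_sub_dilation C0 (fun w => C1%:C *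
    dilation C2 (fun w' => 4 * g w' + r_radial_derive 1 g w') w).

End Estimator.

Section Sampling.
Context {d : measure_display} {T : measurableType d} {R : realType}.
Variable P : probability T R.

Definition uniformly_distributed (X : {RV P >-> R}) : Prop :=
  exists (a b : R) (ab : a < b),
    forall A : set R, measurable A -> distribution P X A = uniform_prob ab A.

Definition mutually_independent (M : nat) (X : 'I_M -> {RV P >-> R}) : Prop :=
  forall (J : {set 'I_M}) (A : 'I_M -> set R),
    (forall j, measurable (A j)) ->
    P (\bigcap_(j in [set` J]) (X j @^-1` A j)) =
    (\prod_(j in J) P (X j @^-1` A j))%E.

Definition independent_samples (X : {RV P >-> R}) (M : nat)
    (Xs : 'I_M -> {RV P >-> R}) : Prop :=
  mutually_independent Xs /\
  forall j (A : set R), measurable A ->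
    distribution P (Xs j) A = distribution P X A.

End Sampling.

(* Main.v *)
Require Import Defs.
From HB Require Import structures.
From mathcomp Require Import all_boot all_order all_algebra.
From mathcomp Require Import complex ring lra.
From mathcomp Require Import all_classical all_reals all_analysis.
From mathcomp Require Import measurable_realfun.

Set Implicit Arguments.
Unset Strict Implicit.
Unset Printing Implicit Defensive.

Import Order.TTheory GRing.Theory Num.Theory.
Import numFieldNormedType.Exports.

Local Open Scope classical_set_scope.
Local Open Scope ring_scope.

(* Put [s_j = 1 - tau_j], [a = sqrt 3 * eta], [B = Bf] and let [E = r d/dr] be the Euler
   operator. Translations cancel in the bispectrum, so [Bf_j w = s_j ^+ 3 * B (s_j w)]
   and [4 g + E g] is the sample mean of [s_j ^+ 3 * H (s_j w)], with [H = 4 B + E B].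
   Since [d/ds (s ^+ 4 * B (s w)) = s ^+ 3 * H (s w)], its expectation is
   [((1 + a) ^+ 4 * B ((1 + a) w) - (1 - a) ^+ 4 * B ((1 - a) w)) / (2 a)], which
   [C1 L_C2] maps to [(I - L_C0) B]. The error [u] therefore solves
   [u - L_C0 u = C1 L_C2 V], where [V] is the deviation of the sample mean from its
   expectation. On L^2, L_C has norm C^3, so [(I - L_C0)^-1] has norm at most
   [1 / (1 - C0 ^+ 3)], and [C1 * C2 ^+ 3 / (1 - C0 ^+ 3) <= 1] gives
   [|u|_2 <= |V|_2]: the factor [eta] of [C1] is lost here. It comes back through the
   variance: independence gives 1/M, and the variance of one sample is at most the mean
   square of [s ^+ 3 * H (s w) - H w], the integral over [v] in [1, s] of
   [v ^+ 2 * (3 H + E H) (v w)], hence of order [eta ^+ 2]. Finally [3 H + E H] is a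
   combination of [B], [r B_r] and [r^2 B_rr]; no term of order [eta ^+ 4] remains. *)

(** Nothing gives square integrability of the estimator in advance: the resolvent is characterized
    among locally bounded functions only, so an operator bound on L^2 cannot simply be applied to
    it. The energy estimate is therefore proved for an arbitrary locally bounded solution, truncated
    to square boxes, which contractions map into themselves. Square norms are integrals of
    nonnegative functions with values in the extended reals, so Tonelli and scaling apply without
    knowing that they are finite. The constant 1 in [|u|_2 <= |V|_2] comes from [1 - C0 = C1 * C2],
    together with [C0 ^+ 3 <= C0] and [C2 ^+ 3 <= C2]. The variance is computed at one frequency at
    a time, where the samples are bounded, and integrated over the plane afterwards. Complex
    functions are split into real and imaginary parts: [L_C], [E] and the sample mean have real
    coefficients, so the analysis concerns real functions. The signal is integrable because one of
    its dilated copies is square integrable with bounded support; the Fourier transform of an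
    observation is then a genuine change of variables. *)

(** * Lebesgue measure on the line and the plane under affine maps *)

Section LebesgueMeasureAffine.
Context {R : realType}.
Local Notation mu := (@lebesgue_measure R).
Local Notation mu2 := (@lebesgue_measure R \x @lebesgue_measure R)%E.

(** The plane carries the product sigma-algebra, not the one generated by its open sets. The two are
    linked by writing an open set as the countable union of the rational boxes that it contains. *)
Lemma open_plane_measurable (U : set (R * R)) : open U ->
  measurable (U : set (measurableTypeR R * measurableTypeR R)).
Proof.
move=> oU.
pose box (a b c d : rat) : set (measurableTypeR R * measurableTypeR R) :=
  `]ratr a, ratr b[%classic `*` `]ratr c, ratr d[%classic.
have -> : U = \bigcup_(a : rat) \bigcup_(b : rat) \bigcup_(c : rat)
    \bigcup_(d : rat) (if `[< box a b c d `<=` U >] then box a b c d else set0).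
  apply/seteqP; split => [[x y] Uxy|[x y] [a _ [b _ [c _ [d _]]]]]; last first.
    by case: asboolP => // + xyb; exact.
  have /nbhs_ballP[e /= e0 eU] : nbhs (x, y) U by exact: open_nbhs_nbhs.
  have rat_in (u v : R) : u < v -> exists q : rat, u < ratr q < v.
    by move=> /rat_in_itvoo[q]; rewrite in_itv/= => ?; exists q.
  have [a /andP[a1 a2]] := rat_in (x - e) x ltac:(lra).
  have [b /andP[b1 b2]] := rat_in x (x + e) ltac:(lra).
  have [c /andP[c1 c2]] := rat_in (y - e) y ltac:(lra).
  have [d /andP[d1 d2]] := rat_in y (y + e) ltac:(lra).
  exists a => //; exists b => //; exists c => //; exists d => //.
  case: asboolP => [_|].
    by split => /=; rewrite in_itv/= ?a2 ?b1 ?c2 ?d1.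
  case=> -[u v] [/=]; rewrite !in_itv/= => /andP[u1 u2] /andP[v1 v2].
  by apply: eU; split; rewrite /ball/= ltr_norml; apply/andP; split; lra.
do 4 (apply: bigcupT_measurable_rat => ?).
case: ifP => // _; apply: measurableX; exact: measurable_itv.
Qed.

Lemma continuous_plane_measurable (g : R * R -> R) : continuous g ->
  measurable_fun [set: measurableTypeR R * measurableTypeR R] g.
Proof.
move=> /continuousP cg; apply: (measurability _ (RGenOpens.measurableE R)).
move=> _ [_ [a [b ->] <-]]; rewrite setTI; apply: open_plane_measurable.
exact/cg/interval_open.
Qed.

(** [a] times the pushforward of Lebesgue measure under [x |-> a * x + b] gives every half-open
    interval its length, so it is Lebesgue measure. *)
Lemma ge0_integral_affine (a b : R) (f : R -> \bar R) : 0 < a ->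
  measurable_fun [set: R] f -> (forall x, 0 <= f x)%E ->
  (\int[mu]_x f (a * x + b)%R = a^-1%:E * \int[mu]_x f x)%E.
Proof.
move=> a0 mf f0.
pose phi : measurableTypeR R -> measurableTypeR R := fun x => a * x + b.
have mphi : measurable_fun setT phi.
  by apply: measurable_funD => //; exact: measurable_funM.
have a0' : 0 <= a by exact: ltW.
pose scaled_pushforward : {measure set (measurableTypeR R) -> \bar R} :=
  mscale (NngNum a0') (pushforward mu phi).
pose m := scaled_pushforward mphi.
have E A : measurable A -> mu A = m A.
  apply: lebesgue_measure_unique => _ [[x y] _ <-].
  rewrite /m/scaled_pushforward/= /mscale/= /pushforward.
  have -> : phi @^-1` `]x, y]%classic = `](x - b) / a, (y - b) / a]%classic.
    apply/seteqP; split => z /=; rewrite !in_itv/= /phi ltr_pdivrMr// ler_pdivlMr//;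
      by move=> /andP[u v]; apply/andP; split; lra.
  rewrite !lebesgue_measure_itv/= !lte_fin ltr_pM2r ?invr_gt0// ltrD2r.
  case: ifP => _; last by rewrite mule0.
  by rewrite -!EFinD -EFinM; congr EFin; field; exact: lt0r_neq0.
transitivity (a^-1%:E * \int[m]_x f x)%E; last first.
  by congr (_ * _)%E; apply: eq_measure_integral => A mA _; exact/esym/E.
rewrite ge0_integral_mscale//= muleA -EFinM mulVf ?gt_eqF// mul1e.
by rewrite ge0_integral_pushforward.
Qed.


(** Source of the L^2 norm [c ^+ 3] of a dilation: the squared weight [c ^+ 8] meets the Jacobian
    factor [c ^- 2]. *)
Lemma ge0_integral_plane_scale (s : R) (g : R * R -> \bar R) : 0 < s ->
  measurable_fun [set: measurableTypeR R * measurableTypeR R] g ->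
  (forall w, 0 <= g w)%E ->
  (\int[mu2]_w g (s * w.1, s * w.2)%R = ((s ^+ 2)^-1)%:E * \int[mu2]_w g w)%E.
Proof.
move=> s0 mg g0.
have ms : measurable_fun [set: measurableTypeR R * measurableTypeR R]
    (fun w => (s * w.1, s * w.2) : measurableTypeR R * measurableTypeR R).
  apply: measurable_fun_pair; apply: measurable_funM => //.
rewrite (@fubini_tonelli1 _ _ _ _ _ mu mu)//; last first.
  exact: measurableT_comp mg ms.
rewrite /fubini_F/= (@fubini_tonelli1 _ _ _ _ _ mu mu)// /fubini_F/=.
have mgF : measurable_fun setT (fun x => \int[mu]_y g (x, y))%E.
  exact: (@measurable_fun_fubini_tonelli_F _ _ _ _ _ mu).
have inner (x : R) : (\int[mu]_y g (s * x, s * y)%R =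
    s^-1%:E * \int[mu]_y g ((s * x)%R, y))%E.
  rewrite -(ge0_integral_affine 0)//.
    by under [RHS]eq_integral do rewrite addr0.
  exact: measurableT_comp mg (measurable_pair1 _).
under eq_integral do rewrite inner.
rewrite ge0_integralZl//; last 3 first.
- by apply: (measurableT_comp mgF); exact: measurable_funM.
- by move=> x _; exact: integral_ge0.
- by rewrite lee_fin invr_ge0 ltW.
under [X in (_ * X)%E]eq_integral do rewrite -[s * _]addr0.
rewrite (ge0_integral_affine 0 (f := fun x => \int[mu]_y g (x, y))%E)//.
  by rewrite muleA -EFinM -invfM expr2.
by move=> x; exact: integral_ge0.
Qed.

Lemma integrable_affine (a b : R) (f : R -> R) : 0 < a ->
  measurable_fun [set: R] f ->
  mu.-integrable setT (EFin \o (fun x => f (a * x + b))) <->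
  mu.-integrable setT (EFin \o f).
Proof.
move=> a0 mf.
have mphi : measurable_fun setT (fun x : R => f (a * x + b)).
  apply: measurableT_comp => //.
  by apply: measurable_funD => //; exact: measurable_funM.
have E : (\int[mu]_x `|(f (a * x + b)%R)%:E| =
    a^-1%:E * \int[mu]_x `|(f x)%:E|)%E.
  by rewrite -(ge0_integral_affine b)//; exact/measurableT_comp/measurable_EFinP.
have iv : (0 < a^-1%:E :> \bar R)%E by rewrite lte_fin invr_gt0.
split=> /integrableP[m i]; apply/integrableP; split;
  do ?exact/measurable_EFinP.
- move: i; rewrite E; rewrite /comp/=.
  have := @integral_ge0 _ _ R mu setT (fun x => `|(f x)%:E|)%E (fun _ _ => abse_ge0 _).
  case: (\int[mu]_x _)%E => [r _ _||] //=; first by rewrite ltry.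
  by rewrite gt0_muley.
- by rewrite E lte_mul_pinfty// ltW.
Qed.

Lemma Rintegral_affine (a b : R) (f : R -> R) : 0 < a ->
  mu.-integrable setT (EFin \o f) ->
  Rintegral mu setT (fun x => f (a * x + b)) = a^-1 * Rintegral mu setT f.
Proof.
move=> a0 fi.
have mf : measurable_fun [set: R] f by move/integrableP: fi => [/measurable_EFinP].
have mE := (measurable_EFinP setT f).2 mf.
rewrite /Rintegral integralE [in RHS]integralE.
have -> : (\int[mu]_x ((fun x => (f (a * x + b))%:E)^\+)%E x =
    \int[mu]_x ((EFin \o f)^\+)%E (a * x + b)%R)%E.
  by apply: eq_integral => x _; rewrite ?funeposE ?funenegE.
have -> : (\int[mu]_x ((fun x => (f (a * x + b))%:E)^\-)%E x =
    \int[mu]_x ((EFin \o f)^\-)%E (a * x + b)%R)%E.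
  by apply: eq_integral => x _; rewrite ?funeposE ?funenegE.
have -> : (fun x => (f x)%:E) = EFin \o f by [].
rewrite (ge0_integral_affine b (f := (EFin \o f)^\+%E))//; last exact: measurable_funepos.
rewrite (ge0_integral_affine b (f := (EFin \o f)^\-%E))//; last exact: measurable_funeneg.
have /fineK <- : (\int[mu]_x (EFin \o f)^\+ x)%E \is a fin_num.
  exact/integral_fune_fin_num/integrable_funepos.
have /fineK <- : (\int[mu]_x (EFin \o f)^\- x)%E \is a fin_num.
  exact/integral_fune_fin_num/integrable_funeneg.
by rewrite -!EFinM -!EFinB/= mulrBr.
Qed.

End LebesgueMeasureAffine.

(** * Calculus in one real variable *)

Section Calculus.
Context {R : realType}.
Local Notation mu := (@lebesgue_measure R).

(* The variance of [q'] over [0, 1] is nonnegative. *)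
Lemma sqr_increment_le_integral (q q' : R -> R) :
  continuous q' -> (forall x : R, is_derive x 1 q (q' x)) ->
  (((q 1 - q 0) ^+ 2)%:E <= \int[mu]_(x in `[0%R, 1%R]) ((q' x) ^+ 2)%:E)%E.
Proof.
move=> cq' dq.
have cq x : {for x, continuous q}.
  by apply: differentiable_continuous; apply/derivable1_diffP; case: (dq x).
have FTC : (\int[mu]_(x in `[0%R, 1%R]) (q' x)%:E = (q 1 - q 0)%:E)%E.
  rewrite (@continuous_FTC2 _ q' q 0 1) ?EFinB//.
  - exact: continuous_subspaceT.
  - split=> [x _||]; first by case: (dq x).
    + exact/cvg_at_right_filter/cq.
    + exact/cvg_at_left_filter/cq.
  - by move=> x _; rewrite derive1E; case: (dq x) => _ ->.
set c := q 1 - q 0 in FTC *.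
have mc (h : R -> R) : continuous h ->
    mu.-integrable `[0%R, 1%R] (EFin \o h).
  move=> ch; apply: continuous_compact_integrable; first exact: segment_compact.
  exact: continuous_subspaceT.
have cq2 : continuous (fun x => q' x ^+ 2).
  by under eq_fun do rewrite expr2; move=> x; apply: cvgM; exact: cq'.
have i1 := mc _ cq'; have i2 := mc _ cq2.
have ccst : continuous (fun _ : R => c ^+ 2) by move=> x; exact: cvg_cst.
have : (0 <= \int[mu]_(x in `[0%R, 1%R]) ((q' x - c) ^+ 2)%:E)%E.
  by apply: integral_ge0 => x _; rewrite lee_fin sqr_ge0.
under eq_integral.
  move=> x _; rewrite (_ : ((q' x - c) ^+ 2)%:E = ((q' x ^+ 2)%:E +
      (- (2 * c))%:E * (q' x)%:E + (c ^+ 2)%:E)%E); last first.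
    by rewrite -EFinM -!EFinD; congr EFin; ring.
  over.
rewrite integralD//=; last 2 first.
- by apply: integrableD => //; apply: integrableZl.
- exact: mc.
rewrite integralD//=; last exact: integrableZl.
rewrite integralZl// FTC integral_cst//= lebesgue_measure_itv/= lte_fin ltr01 oppr0 adde0 mule1.
have := integrable_fin_num _ i2 => /(_ (measurable_itv _)).
case: (\int[mu]_(x in _) _)%E => // r _.
by rewrite -!EFinM -!EFinD !lee_fin; lra.
Qed.

Lemma integral_derive_continuous (a b : R) (q q' : R -> R) : a < b ->
  continuous q' -> (forall x : R, is_derive x 1 q (q' x)) ->
  (\int[mu]_(x in `[a, b]) (q' x)%:E = (q b - q a)%:E)%E.
Proof.
move=> ab cq' dq.
have cq x : {for x, continuous q}.
  by apply: differentiable_continuous; apply/derivable1_diffP; case: (dq x).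
rewrite (@continuous_FTC2 _ q' q a b) ?EFinB//.
- exact: continuous_subspaceT.
- split=> [x _||]; first by case: (dq x).
  + exact/cvg_at_right_filter/cq.
  + exact/cvg_at_left_filter/cq.
- by move=> x _; rewrite derive1E; case: (dq x) => _ ->.
Qed.

Lemma is_derive_expn n (x : R) :
  is_derive x 1 (fun u : R => u ^+ n.+1) (n.+1%:R * x ^+ n).
Proof.
apply: DeriveDef; first exact: exprn_derivable.
by rewrite exp_derive/= /GRing.scale/= mulr1.
Qed.

Lemma is_derive_primitive_expn n (x : R) :
  is_derive x 1 (fun u : R => u ^+ n.+1 / n.+1%:R) (x ^+ n).
Proof.
have -> : (fun u : R => u ^+ n.+1 / n.+1%:R) =
    n.+1%:R^-1 \*: (fun u : R => u ^+ n.+1).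
  by apply/funext => u; rewrite mulrC.
have -> : x ^+ n = n.+1%:R^-1 *: (n.+1%:R * x ^+ n).
  by rewrite /GRing.scale/= mulKf// pnatr_eq0.
apply: is_deriveZ; exact: is_derive_expn.
Qed.

End Calculus.

(** * Differentiation along rays *)

Section RadialCalculus.
Context {R : realType}.
Implicit Types g : R * R -> R.

(** Cartesian form of [r d/dr]. Unlike the polar form it needs no angle, is regular at the origin
    and maps [Ck k.+1] to [Ck k], so it can be iterated. *)
Definition euler g : R * R -> R :=
  fun w => w.1 * 'D_(1, 0) g w + w.2 * 'D_(0, 1) g w.

Lemma Ck_continuous k g : Ck k g -> continuous g.
Proof. by case: k => [|k] []. Qed.

Lemma CkS k g : Ck k.+1 g -> Ck k g.
Proof.
elim: k g => [|k IH] g; first by case.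
move=> [cg [d1 d2 C1 C2]]; split; first exact: cg.
by split; [exact: d1|exact: d2|exact: IH C1|exact: IH C2].
Qed.

Lemma Ck_ext k (g h : R * R -> R) : g =1 h -> Ck k h -> Ck k g.
Proof. by move=> /funext ->. Qed.

Lemma Ck_cst k (c : R) : Ck k (fun=> c).
Proof.
elim: k c => [|k IH] c; first by split=> // w; exact: cvg_cst.
split; first by move=> w; exact: cvg_cst.
split; do ?by move=> w; exact: derivable_cst.
all: by apply: (Ck_ext (h := fun=> 0)) => // w; exact: derive_cst.
Qed.

Lemma CkD k (g h : R * R -> R) : Ck k g -> Ck k h -> Ck k (fun w => g w + h w).
Proof.
elim: k g h => [|k IH] g h.
  by move=> [cg _] [ch _]; split=> // w; apply: cvgD; [exact: cg|exact: ch].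
move=> [cg [g1 g2 Cg1 Cg2]] [ch [h1 h2 Ch1 Ch2]].
split; first by move=> w; apply: cvgD; [exact: cg|exact: ch].
split; do ?by move=> w; exact: derivableD.
- rewrite (_ : (fun w => _) = (fun w => 'D_(1, 0) g w + 'D_(1, 0) h w)).
    exact: IH.
  by apply/funext => w; rewrite deriveD.
- rewrite (_ : (fun w => _) = (fun w => 'D_(0, 1) g w + 'D_(0, 1) h w)).
    exact: IH.
  by apply/funext => w; rewrite deriveD.
Qed.

Lemma CkM k (g h : R * R -> R) : Ck k g -> Ck k h -> Ck k (fun w => g w * h w).
Proof.
elim: k g h => [|k IH] g h.
  by move=> [cg _] [ch _]; split=> // w; apply: cvgM; [exact: cg|exact: ch].
move=> Cg Ch; have Cg' := CkS Cg; have Ch' := CkS Ch.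
move: Cg Ch => [cg [g1 g2 Cg1 Cg2]] [ch [h1 h2 Ch1 Ch2]].
split; first by move=> w; apply: cvgM; [exact: cg|exact: ch].
split; do ?by move=> w; exact: derivableM.
- rewrite (_ : (fun w => _) =
      (fun w => g w * 'D_(1, 0) h w + h w * 'D_(1, 0) g w)).
    by apply: CkD; exact: IH.
  by apply/funext => w; rewrite deriveM.
- rewrite (_ : (fun w => _) =
      (fun w => g w * 'D_(0, 1) h w + h w * 'D_(0, 1) g w)).
    by apply: CkD; exact: IH.
  by apply/funext => w; rewrite deriveM.
Qed.

Lemma is_derive_fst (w v : R * R) : is_derive w v (fst : R * R -> R) v.1.
Proof.
have lim : (fun h : R => h^-1 *: ((fst \o shift w) (h *: v) - w.1)) @ 0^' --> v.1.
  apply: (@cvg_trans _ ((fun=> v.1) @ (0 : R)^')); last exact: cvg_cst.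
  apply: near_eq_cvg; near=> h.
  have h0 : h != 0 by near: h; exact: nbhs_dnbhs_neq.
  by rewrite /= addrK scalerA mulVf// scale1r.
apply: DeriveDef; first by apply/cvg_ex; eexists; exact: lim.
exact/cvg_lim.
Unshelve. all: by end_near. Qed.

Lemma is_derive_snd (w v : R * R) : is_derive w v (snd : R * R -> R) v.2.
Proof.
have lim : (fun h : R => h^-1 *: ((snd \o shift w) (h *: v) - w.2)) @ 0^' --> v.2.
  apply: (@cvg_trans _ ((fun=> v.2) @ (0 : R)^')); last exact: cvg_cst.
  apply: near_eq_cvg; near=> h.
  have h0 : h != 0 by near: h; exact: nbhs_dnbhs_neq.
  by rewrite /= addrK scalerA mulVf// scale1r.
apply: DeriveDef; first by apply/cvg_ex; eexists; exact: lim.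
exact/cvg_lim.
Unshelve. all: by end_near. Qed.

Lemma Ck_fst k : Ck k (fst : R * R -> R).
Proof.
case: k => [|k]; first by split=> // w; exact: cvg_fst.
split; first by move=> w; exact: cvg_fst.
split=> [w|w||].
- by case: (is_derive_fst w (1, 0)).
- by case: (is_derive_fst w (0, 1)).
- apply: (Ck_ext (h := fun=> 1)); last exact: Ck_cst.
  by move=> w; case: (is_derive_fst w (1, 0)).
- apply: (Ck_ext (h := fun=> 0)); last exact: Ck_cst.
  by move=> w; case: (is_derive_fst w (0, 1)).
Qed.

Lemma Ck_snd k : Ck k (snd : R * R -> R).
Proof.
case: k => [|k]; first by split=> // w; exact: cvg_snd.
split; first by move=> w; exact: cvg_snd.
split=> [w|w||].
- by case: (is_derive_snd w (1, 0)).
- by case: (is_derive_snd w (0, 1)).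
- apply: (Ck_ext (h := fun=> 0)); last exact: Ck_cst.
  by move=> w; case: (is_derive_snd w (1, 0)).
- apply: (Ck_ext (h := fun=> 1)); last exact: Ck_cst.
  by move=> w; case: (is_derive_snd w (0, 1)).
Qed.

Lemma Ck_euler k g : Ck k.+1 g -> Ck k (euler g).
Proof.
move=> [_ [_ _ C1 C2]]; apply: CkD; apply: CkM => //.
  exact: Ck_fst.
exact: Ck_snd.
Qed.

Lemma is_derive_section1 g (x y : R) : derivable g (x, y) (1, 0) ->
  is_derive x 1 (fun u => g (u, y)) ('D_(1, 0) g (x, y)).
Proof.
move=> dg.
have E : (fun h : R => h^-1 *: (((fun u => g (u, y)) \o shift x) (h *: 1) - g (x, y)))
    = (fun h => h^-1 *: ((g \o shift (x, y)) (h *: ((1, 0) : R * R)) - g (x, y))).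
  apply/funext => h; congr (_ *: (g _ - _)).
  by congr pair => /=; rewrite scaler0 add0r.
by apply: DeriveDef; rewrite /derivable /derive E.
Qed.

Lemma is_derive_section2 g (x y : R) : derivable g (x, y) (0, 1) ->
  is_derive y 1 (fun u => g (x, u)) ('D_(0, 1) g (x, y)).
Proof.
move=> dg.
have E : (fun h : R => h^-1 *: (((fun u => g (x, u)) \o shift y) (h *: 1) - g (x, y)))
    = (fun h => h^-1 *: ((g \o shift (x, y)) (h *: ((0, 1) : R * R)) - g (x, y))).
  apply/funext => h; congr (_ *: (g _ - _)).
  by congr pair => /=; rewrite scaler0 add0r.
by apply: DeriveDef; rewrite /derivable /derive E.
Qed.

(** The order of [u] and [v] is left open because the increments of a difference quotient have
    either sign. *)
Lemma mean_value (f df : R -> R) (u v : R) :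
  (forall x : R, is_derive x 1 f (df x)) ->
  exists2 c, `|c - u| <= `|v - u| & f v - f u = df c * (v - u).
Proof.
move=> dF.
have cf : continuous f.
  by move=> x; apply: differentiable_continuous; apply/derivable1_diffP; case: (dF x).
have [uv|vu] := leP u v.
  have [c] := MVT_segment uv (fun x _ => dF x) (continuous_subspaceT cf).
  rewrite in_itv/= => /andP[uc cv] E; exists c => //.
  by rewrite !ger0_norm; lra.
have [c] := MVT_segment (ltW vu) (fun x _ => dF x) (continuous_subspaceT cf).
rewrite in_itv/= => /andP[uc cv] E; exists c; last lra.
by rewrite !ler0_norm; lra.
Qed.

(** [Ck] speaks of the two partial derivatives only, so the chain rule has to be earned: the
    increment along the ray is split into a horizontal and a vertical one, the mean value theorem
    applies to each, and the intermediate points converge by continuity of the partial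
    derivatives. *)
Lemma is_derive_ray g (a b s : R) : Ck 1 g ->
  is_derive s 1 (fun u => g (u * a, u * b))
    (a * 'D_(1, 0) g (s * a, s * b) + b * 'D_(0, 1) g (s * a, s * b)).
Proof.
move=> [cg [d1 d2 [c1 _] [c2 _]]].
set D1 := fun w => 'D_(1, 0) g w in c1 *; set D2 := fun w => 'D_(0, 1) g w in c2 *.
have key (h : R) : exists c : R * R, [/\ `|c.1 - s * a| <= `|h * a|,
    `|c.2 - s * b| <= `|h * b| &
    g ((h + s) * a, (h + s) * b) - g (s * a, s * b) =
    h * (a * D1 (c.1, (h + s) * b) + b * D2 (s * a, c.2))].
  have [x0 H1 E1] := @mean_value (fun u => g (u, (h + s) * b))
    (fun u => D1 (u, (h + s) * b)) (s * a) ((h + s) * a)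
    (fun x => is_derive_section1 (d1 _)).
  have [y0 H2 E2] := @mean_value (fun u => g (s * a, u))
    (fun u => D2 (s * a, u)) (s * b) ((h + s) * b)
    (fun x => is_derive_section2 (d2 _)).
  exists (x0, y0); split => /=.
  - by apply: le_trans H1 _; rewrite le_eqVlt; apply/orP; left; apply/eqP; congr `|_|; ring.
  - by apply: le_trans H2 _; rewrite le_eqVlt; apply/orP; left; apply/eqP; congr `|_|; ring.
  - transitivity (g ((h + s) * a, (h + s) * b) - g (s * a, (h + s) * b) +
      (g (s * a, (h + s) * b) - g (s * a, s * b))); first by ring.
    by rewrite E1 E2; ring.
have lim : (fun h : R => h^-1 *: (((fun u => g (u * a, u * b)) \o shift s) (h *: 1)
      - g (s * a, s * b))) @ 0^' -->
    a * D1 (s * a, s * b) + b * D2 (s * a, s * b).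
  (* A choice of intermediate points for every increment [h]; only their distance to the base point
     is controlled, which is enough for the limit. *)
  pose c h := sval (cid (key h)).
  have cP h : [/\ `|(c h).1 - s * a| <= `|h * a|,
    `|(c h).2 - s * b| <= `|h * b| &
    g ((h + s) * a, (h + s) * b) - g (s * a, s * b) =
    h * (a * D1 ((c h).1, (h + s) * b) + b * D2 (s * a, (c h).2))].
    by rewrite /c; case: cid.
  have cvc1 : (c h).1 @[h --> 0^'] --> s * a.
    apply/cvgrPdist_le => e e0.
    have : (fun h : R => h * a) @ 0^' --> 0 * a.
      by apply: cvgMl; exact: cvg_within.
    move=> /cvgrPdist_le/(_ e e0); apply: filterS => h.
    rewrite mul0r sub0r normrN => he.
    by rewrite distrC; apply: le_trans he; case: (cP h).
  have cvc2 : (c h).2 @[h --> 0^'] --> s * b.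
    apply/cvgrPdist_le => e e0.
    have : (fun h : R => h * b) @ 0^' --> 0 * b.
      by apply: cvgMl; exact: cvg_within.
    move=> /cvgrPdist_le/(_ e e0); apply: filterS => h.
    rewrite mul0r sub0r normrN => he.
    by rewrite distrC; apply: le_trans he; case: (cP h).
  have cvb : (h + s) * b @[h --> 0^'] --> s * b.
    rewrite -{2}[s]add0r; apply: cvgMl; apply: cvgD; last exact: cvg_cst.
    exact: cvg_within.
  apply: (@cvg_trans _ ((fun h => a * D1 ((c h).1, (h + s) * b) +
      b * D2 (s * a, (c h).2)) @ 0^')).
    apply: near_eq_cvg; near=> h.
    have h0 : h != 0 by near: h; exact: nbhs_dnbhs_neq.
    have [_ _ E] := cP h.
    by rewrite /= /GRing.scale/= mulr1 E mulrA mulVf// mul1r.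
  apply: cvgD; apply: cvgMr.
  - apply: (@cvg_comp _ _ _ (fun h => ((c h).1, (h + s) * b)) D1 _ (nbhs (s * a, s * b))).
      exact: cvg_pair cvc1 cvb.
    exact: c1.
  - apply: (@cvg_comp _ _ _ (fun h => (s * a, (c h).2)) D2 _ (nbhs (s * a, s * b))).
      exact: (cvg_pair (cvg_cst (s * a)) cvc2).
    exact: c2.
apply: DeriveDef; first by apply/cvg_ex; eexists; exact: lim.
exact/cvg_lim.
Unshelve. all: by end_near. Qed.

(** By the product rule; the factor [v] left over from [v ^+ n.+1] turns the derivative along the
    ray into the Euler operator at the point reached. The case [n = 3] yields the mean of a sample,
    the case [n = 2] its increments. *)
Lemma is_derive_pow_ray n g (a b v : R) : Ck 1 g ->
  is_derive v 1 (fun u => u ^+ n.+1 * g (u * a, u * b))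
    (v ^+ n * (n.+1%:R * g (v * a, v * b) + euler g (v * a, v * b))).
Proof.
move=> Cg; have Dg := is_derive_ray a b v Cg.
have -> : v ^+ n * (n.+1%:R * g (v * a, v * b) + euler g (v * a, v * b)) =
    v ^+ n.+1 *: (a * 'D_(1, 0) g (v * a, v * b) + b * 'D_(0, 1) g (v * a, v * b))
    + g (v * a, v * b) *: (n.+1%:R * v ^+ n).
  by rewrite /euler /GRing.scale/= exprS; ring.
exact: is_deriveM (is_derive_expn n v) Dg.
Qed.

(** The sine of an [acos] is nonnegative, hence the sign change of [angle] in the lower half-plane.
    At the origin the radius vanishes and the angle does not matter. *)
Lemma polarK (w : R * R) :
  (Defs.radius w * cos (angle w), Defs.radius w * sin (angle w)) = w.
Proof.
case: w => x y; rewrite /angle /Defs.radius/=.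
have s0 : 0 <= x ^+ 2 + y ^+ 2 by rewrite addr_ge0// sqr_ge0.
set r := Num.sqrt _.
have r2 : r ^+ 2 = x ^+ 2 + y ^+ 2 by rewrite sqr_sqrtr.
have r0 : 0 <= r by exact: sqrtr_ge0.
have [r_eq0|rn0] := eqVneq r 0.
  have : x ^+ 2 + y ^+ 2 = 0 by rewrite -r2 r_eq0 expr0n.
  move=> /eqP; rewrite paddr_eq0 ?sqr_ge0// !sqrf_eq0 => /andP[/eqP-> /eqP->].
  by rewrite r_eq0 !mul0r.
have rp : 0 < r by rewrite lt_neqAle eq_sym rn0.
have xr : -1 <= x / r <= 1.
  rewrite ler_pdivlMr// ler_pdivrMr//.
  have : x ^+ 2 <= r ^+ 2 by rewrite r2 lerDl sqr_ge0.
  by move=> xr; apply/andP; split; nra.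
have sq : r * Num.sqrt (1 - (x / r) ^+ 2) = `|y|.
  rewrite -{1}(ger0_norm r0) -sqrtr_sqr -sqrtrM ?sqr_ge0//.
  rewrite mulrBr mulr1 -exprMn mulrCA divff// mulr1 r2 addrAC subrr add0r.
  by rewrite sqrtr_sqr.
have xE : r * (x / r) = x by rewrite mulrCA divff// mulr1.
case: ifPn => [y0|].
  by rewrite acosK ?sin_acos// sq ger0_norm// xE.
rewrite -ltNge => y0.
by rewrite cosN sinN acosK ?sin_acos// mulrN sq ltr0_norm// opprK xE.
Qed.

Lemma radius_derive1 g (w : R * R) : Ck 1 g ->
  Defs.radius w ^+ 1 * derive1n 1 (fun s => g (s * cos (angle w), s * sin (angle w)))
    (Defs.radius w) = euler g w.
Proof.
move=> Cg; rewrite expr1 /derive1n/= derive1E.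
case: (is_derive_ray (cos (angle w)) (sin (angle w)) (Defs.radius w) Cg) => _ ->.
have /= E1 := congr1 fst (polarK w); have /= E2 := congr1 snd (polarK w).
by rewrite polarK mulrDr !mulrA E1 E2.
Qed.

(** Applying [r d/dr] twice gives [r^2 d^2/dr^2 + r d/dr], whence the subtracted term. *)
Lemma radius_derive2 g (w : R * R) : Ck 2 g ->
  Defs.radius w ^+ 2 * derive1n 2 (fun s => g (s * cos (angle w), s * sin (angle w)))
    (Defs.radius w) = euler (euler g) w - euler g w.
Proof.
move=> Cg; have C1g := CkS Cg; have CE := Ck_euler Cg.
set a := cos _; set b := sin _; set r := Defs.radius w.
have D1 := is_derive_ray a b _ C1g; have DE := is_derive_ray a b r CE.
have E1 : derive1 (fun s => g (s * a, s * b)) =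
    (fun s => a * 'D_(1, 0) g (s * a, s * b) + b * 'D_(0, 1) g (s * a, s * b)).
  by apply/funext => s; rewrite derive1E; case: (D1 s).
move: Cg => [_ [_ _ Ca Cb]].
have Da := is_derive_ray a b r Ca; have Db := is_derive_ray a b r Cb.
set q := (fun s => a * 'D_(1, 0) g (s * a, s * b) + b * 'D_(0, 1) g (s * a, s * b)) in E1.
have dq : derivable q r 1.
  by apply: derivableD; apply: derivableM => //; case: Da; case: Db.
have qE : (fun s => euler g (s * a, s * b)) = (fun s => s * q s).
  by apply/funext => s; rewrite /euler /q/=; ring.
have E2 : derive1 (fun s => euler g (s * a, s * b)) r = q r + r * derive1 q r.
  rewrite qE !derive1E deriveM//= derive_id /GRing.scale/=; ring.
have E3 : r * derive1 (fun s => euler g (s * a, s * b)) r = euler (euler g) w.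
  by rewrite -radius_derive1.
have E4 : r * q r = euler g w.
  by rewrite -E1 -radius_derive1.
rewrite -E3 E2 -E4 /derive1n/= E1; ring.
Qed.

End RadialCalculus.

(** * Uniform samples *)

Section UniformSamples.
Context {d : measure_display} {T : measurableType d} {R : realType}.
Variable P : probability T R.
Local Notation mu := (@lebesgue_measure R).

Lemma ge0_integral_uniform_sample (X : {RV P >-> R}) (a b : R) (ab : a < b)
    (phi : R -> \bar R) :
  (forall A : set R, measurable A -> distribution P X A = uniform_prob ab A) ->
  measurable_fun [set: R] phi -> (forall x, 0 <= phi x)%E ->
  (\int[P]_w phi (X w) = (b - a)^-1%:E * \int[mu]_(x in `[a, b]) phi x)%E.
Proof.
move=> XU mphi phi0.
pose Y : T -> measurableTypeR R := X.
have mY : measurable_fun setT Y by exact: (measurable_funP X).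
rewrite -(integral_uniform ab)//.
transitivity (\int[pushforward P Y]_y phi y)%E.
  by rewrite ge0_integral_pushforward.
apply: (@eq_measure_integral _ (measurableTypeR R) R setT (uniform_prob ab)) => A mA _.
exact: XU.
Qed.

Lemma integral_uniform_sample (X : {RV P >-> R}) (a b : R) (ab : a < b)
    (phi : R -> R) :
  (forall A : set R, measurable A -> distribution P X A = uniform_prob ab A) ->
  continuous phi ->
  (\int[P]_w (phi (X w))%:E = (b - a)^-1%:E * \int[mu]_(x in `[a, b]) (phi x)%:E)%E.
Proof.
move=> XU cphi.
have iphi : mu.-integrable `[a, b] (EFin \o phi).
  apply: continuous_compact_integrable; first exact: segment_compact.
  exact: continuous_subspaceT.
have mphi : measurable_fun [set: R] (EFin \o phi).
  by apply/measurable_EFinP; exact: continuous_measurable_fun.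
rewrite integralE [in RHS]integralE.
have Ep : (\int[P]_w ((fun w => (phi (X w))%:E)^\+)%E w =
    \int[P]_w ((EFin \o phi)^\+)%E (X w))%E.
  by apply: eq_integral => w _; rewrite !funeposE.
have En : (\int[P]_w ((fun w => (phi (X w))%:E)^\-)%E w =
    \int[P]_w ((EFin \o phi)^\-)%E (X w))%E.
  by apply: eq_integral => w _; rewrite !funenegE.
rewrite Ep En.
rewrite !(ge0_integral_uniform_sample XU)//; last 2 first.
- exact: measurable_funeneg.
- exact: measurable_funepos.
have -> : (fun x => (phi x)%:E) = EFin \o phi by [].
have /fineK <- : (\int[mu]_(x in `[a, b]) (EFin \o phi)^\+ x)%E \is a fin_num.
  exact/integral_fune_fin_num/integrable_funepos.
have /fineK <- : (\int[mu]_(x in `[a, b]) (EFin \o phi)^\- x)%E \is a fin_num.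
  exact/integral_fune_fin_num/integrable_funeneg.
by rewrite muleBr.
Qed.

(** A mean of zero makes the interval symmetric, and the second moment [b ^+ 2 / 3] of the uniform
    law on [[- b, b]] then determines [b]. *)
Lemma uniform_sampleP (X : {RV P >-> R}) (eta : R) : 0 < eta ->
  uniformly_distributed X -> ('E_P[X] = 0)%E -> ('V_P[X] = (eta ^+ 2)%:E)%E ->
  exists ab : - (Num.sqrt 3 * eta) < Num.sqrt 3 * eta,
    forall A : set R, measurable A -> distribution P X A = uniform_prob ab A.
Proof.
move=> eta0 [a [b [ab XU]]].
have cid : continuous (fun x : R => x) by move=> x; exact: cvg_id.
have csq : continuous (fun x : R => x ^+ 2) by exact: exprn_continuous.
have ba0 : 0 < b - a by rewrite subr_gt0.
move=> EX0; have := EX0; rewrite unlock => EX.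
rewrite /variance covariance.unlock EX0/= unlock.
have {EX} : a + b = 0.
  move: EX; rewrite (integral_uniform_sample XU cid).
  have D2 (x : R) : is_derive x 1 (fun u : R => u ^+ 2 / 2) x.
    by have := is_derive_primitive_expn 1 x; rewrite expr1.
  rewrite (integral_derive_continuous ab cid D2).
  rewrite -EFinM => -[] /eqP; rewrite mulf_eq0 invr_eq0 gt_eqF//= => /eqP.
  move=> E; have : (b - a) * (b + a) = 0 by nra.
  by move=> /eqP; rewrite mulf_eq0 gt_eqF//= => /eqP; lra.
move=> ab0.
have -> : (\int[P]_w (((X \- cst 0) * (X \- cst 0)) w)%:E =
    \int[P]_w (X w ^+ 2)%:E)%E.
  apply: eq_integral => w _; transitivity ((X w - 0) * (X w - 0))%:E => //.
  by rewrite subr0 expr2.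
rewrite (integral_uniform_sample XU csq).
rewrite (integral_derive_continuous ab csq (is_derive_primitive_expn 2)).
rewrite -EFinM => -[E].
have aE : a = - b by lra.
have b0 : 0 < b by lra.
have bE : b = Num.sqrt 3 * eta.
  have : b ^+ 2 = 3 * eta ^+ 2.
    rewrite -E aE; field; lra.
  have -> : 3 * eta ^+ 2 = (Num.sqrt 3 * eta) ^+ 2 by rewrite exprMn sqr_sqrtr.
  by move=> /eqP; rewrite eqrXn2 ?mulr_ge0 ?sqrtr_ge0 ?(ltW eta0) ?(ltW b0)// => /eqP.
subst a; rewrite bE in ab XU.
by exists ab.
Qed.

Lemma uniform_sample_bounded (X : {RV P >-> R}) (a b : R) (ab : a < b) :
  (forall A : set R, measurable A -> distribution P X A = uniform_prob ab A) ->
  {ae P, forall w, a <= X w <= b}.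
Proof.
move=> XU.
exists (X @^-1` ~` `[a, b]%classic); split.
- rewrite -[X in measurable X]setTI; apply: measurable_funP => //.
  by apply: measurableC; exact: measurable_itv.
- rewrite -[LHS]/(distribution P X _) XU; last by apply: measurableC; exact: measurable_itv.
  rewrite /uniform_prob integral_uniform_pdf setICl.
  exact: integral_set0.
- by move=> w /= H; rewrite in_itv/=.
Qed.

Lemma integrable_bounded_sample (phi : T -> R) (B : R) :
  measurable_fun setT phi -> (forall x, `|phi x| <= B) ->
  P.-integrable setT (EFin \o phi).
Proof.
move=> mphi phiB; apply: measurable_bounded_integrable => //.
  by rewrite (le_lt_trans (probability_le1 _ _))// ltry.
exists B; split; first exact: num_real.
by move=> M BM x _ /=; apply: le_trans (phiB x) (ltW BM).
Qed.

(** Independence says that the joint law and the product of the two laws agree on rectangles, hence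
    everywhere; Fubini then separates the factors, boundedness providing integrability. *)
Lemma independent_pair_integral (X Y : {RV P >-> R}) (f g : R -> R) (B : R) :
  (forall A B : set R, measurable A -> measurable B ->
    P (X @^-1` A `&` Y @^-1` B) = (P (X @^-1` A) * P (Y @^-1` B))%E) ->
  measurable_fun setT f -> measurable_fun setT g ->
  (forall x, `|f x| <= B) -> (forall x, `|g x| <= B) ->
  (\int[P]_w (f (X w) * g (Y w))%:E =
   (\int[P]_w (f (X w))%:E) * (\int[P]_w (g (Y w))%:E))%E.
Proof.
move=> XY mf mg fB gB.
pose Z : T -> R * R := fun w => (X w, Y w).
have mZ : measurable_fun setT Z by apply: measurable_fun_pair; exact: measurable_funP.
pose Zm := isMeasurableFun.Build _ _ _ _ Z mZ.
pose ZZ : {mfun T >-> _} := HB.pack Z Zm.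
pose fg (z : R * R) := (f z.1 * g z.2)%:E.
have mfg : measurable_fun setT fg.
  by apply/measurable_EFinP/measurable_funM; exact: measurableT_comp.
have B0 : 0 <= B by apply: le_trans (fB 0).
have fgB x y : `|f x * g y| <= B * B.
  by rewrite normrM ler_pM.
have ifg : P.-integrable setT (fg \o ZZ).
  apply: (@integrable_bounded_sample (fun w => f (X w) * g (Y w)) (B * B)) => //.
  by apply: measurable_funM; exact: measurableT_comp.
have EZ A : measurable A ->
    (distribution P X \x distribution P Y)%E A = distribution P ZZ A.
  apply: product_measure_unique => A1 A2 mA1 mA2.
  rewrite /distribution /pushforward -XY//; congr (P _).
rewrite -[LHS]/(\int[P]_w (fg \o ZZ) w)%E -integral_distribution//.
transitivity (\int[distribution P X \x distribution P Y]_z fg z)%E.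
  by apply: eq_measure_integral => A mA _; exact/esym/EZ.
rewrite -fubini1; last first.
  apply: (@measurable_bounded_integrable _ _ _ _ (fun z => f z.1 * g z.2)) => //.
  - by rewrite [ltLHS](EZ _ measurableT) ltey_eq fin_num_measure.
  - by apply: measurable_funM; exact: measurableT_comp.
  - exists (B * B); split; first exact: num_real.
    by move=> M BM x _ /=; apply: le_trans (fgB _ _) (ltW BM).
rewrite /fubini_F/= /fg/=.
have iX (h : R -> R) (V : {RV P >-> R}) : measurable_fun setT h ->
    (forall x, `|h x| <= B) -> (distribution P V).-integrable setT (EFin \o h).
  move=> mh hB; apply: measurable_bounded_integrable => //.
    by rewrite ltey_eq fin_num_measure.
  exists B; split; first exact: num_real.
  by move=> M BM x _ /=; apply: le_trans (hB _) (ltW BM).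
under eq_integral.
  move=> x _; under eq_integral do rewrite EFinM.
  rewrite integralZl//; last exact: iX.
  over.
have fg_fin : (\int[distribution P Y]_y (g y)%:E)%E \is a fin_num.
  exact/integral_fune_fin_num/iX.
rewrite -(fineK fg_fin) integralZr//; last exact: iX.
rewrite fineK//; congr (_ * _)%E.
  rewrite (@integral_distribution _ _ _ _ _ _ X (EFin \o f))//.
    exact/measurable_EFinP.
  apply: (@integrable_bounded_sample (f \o X) B) => [|x]; last exact: fB.
  exact: measurableT_comp.
rewrite (@integral_distribution _ _ _ _ _ _ Y (EFin \o g))//.
  exact/measurable_EFinP.
apply: (@integrable_bounded_sample (g \o Y) B) => [|x]; last exact: gB.
  exact: measurableT_comp.
Qed.

(** The square of the centered sum is expanded: off-diagonal terms vanish by independence and the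
    [M] diagonal ones are each at most [V]. The center [c] is free, so that [V] may be a mean square
    about a value more convenient than the mean. *)
Lemma sample_mean_variance (M : nat) (Xs : 'I_M -> {RV P >-> R}) (phi : R -> R)
    (B m c V : R) : (0 < M)%N -> mutually_independent Xs ->
  measurable_fun setT phi -> (forall x, `|phi x| <= B) ->
  (forall j, \int[P]_w (phi (Xs j w))%:E = m%:E)%E ->
  (forall j, \int[P]_w ((phi (Xs j w) - c) ^+ 2)%:E = V%:E)%E ->
  (\int[P]_w ((m - M%:R^-1 * \sum_(j < M) phi (Xs j w)) ^+ 2)%:E <=
   (V / M%:R)%:E)%E.
Proof.
move=> M0 ind mphi phiB Em EV.
have Mn0 : M%:R != 0 :> R by rewrite pnatr_eq0 -lt0n.
pose Y j w := phi (Xs j w) - m.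
pose psi x := phi x - m.
have B0 : 0 <= B by apply: le_trans (phiB 0).
have psiB x : `|psi x| <= B + `|m| by apply: le_trans (ler_normB _ _) _; rewrite lerD2r.
have mpsi : measurable_fun setT psi by exact: measurable_funB.
have iphi j : P.-integrable setT (EFin \o (fun w => phi (Xs j w))).
  by apply: (@integrable_bounded_sample _ B) => //; exact: measurableT_comp.
have EY j : (\int[P]_w (Y j w)%:E = 0)%E.
  under eq_integral do rewrite EFinB.
  rewrite integralB//=; [|exact: iphi|exact: finite_measure_integrable_cst].
  by rewrite Em integral_cst//= probability_setT mule1 subee.
have mY2 i j : measurable_fun setT (fun w => Y i w * Y j w).
  by apply: measurable_funM; exact: (measurableT_comp mpsi).
have YB i j w : `|Y i w * Y j w| <= (B + `|m|) * (B + `|m|).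
  by rewrite normrM ler_pM// psiB.
have iY2 i j : P.-integrable setT (EFin \o (fun w => Y i w * Y j w)).
  exact: (@integrable_bounded_sample _ _ (mY2 i j) (YB i j)).
have EYY i j : i != j -> (\int[P]_w (Y i w * Y j w)%:E = 0)%E.
  move=> ij; rewrite (@independent_pair_integral (Xs i) (Xs j) psi psi _ _ mpsi mpsi psiB psiB).
    by rewrite EY mul0e.
  move=> A C mA mC.
  (* Independence of the whole family, read on the index set [{i, j}]. *)
  pose AC k := if k == i then A else C.
  have mAC k : measurable (AC k) by rewrite /AC; case: ifP.
  have := ind [set i; j]%SET AC mAC.
  rewrite big_setU1 ?inE//= big_set1 /AC eqxx eq_sym (negbTE ij) => <-.
  congr (P _); apply/seteqP; split=> w /=.
    by move=> [wA wC] k /=; rewrite !inE => /orP[]/eqP->; rewrite ?eqxx// eq_sym (negbTE ij).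
  move=> H; split.
    by have := H i; rewrite /= !inE !eqxx; exact.
  by have := H j; rewrite /= !inE !eqxx orbT eq_sym (negbTE ij); exact.
(* The mean square about [c] exceeds the variance by exactly [(m - c) ^+ 2]. *)
have EY2 j : (\int[P]_w (Y j w * Y j w)%:E <= V%:E)%E.
  have -> : V%:E = (\int[P]_w (Y j w * Y j w + (2 * (m - c) * Y j w + (m - c) ^+ 2))%:E)%E.
    by rewrite -(EV j); apply: eq_integral => w _; congr EFin; rewrite /Y; ring.
  have iYj : P.-integrable setT (EFin \o Y j).
    apply: (@integrable_bounded_sample (Y j) (B + `|m|)); first exact: (measurableT_comp mpsi).
    by move=> x; exact: psiB.
  under [leRHS]eq_integral do rewrite !EFinD [X in (_ + (X + _))%E]EFinM.
  rewrite [leRHS]integralD//=; [|exact: iY2|]; last first.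
    apply: integrableD => //; first exact: integrableZl.
    exact: finite_measure_integrable_cst.
  rewrite integralD//=; [|exact: integrableZl|exact: finite_measure_integrable_cst].
  rewrite integralZl// EY mule0 add0e integral_cst//= probability_setT mule1.
  by rewrite leeDl// lee_fin sqr_ge0.
have -> : (\int[P]_w ((m - M%:R^-1 * \sum_(j < M) phi (Xs j w)) ^+ 2)%:E =
    \int[P]_w ((M%:R ^-2)%:E * (\sum_(i < M) \sum_(j < M) (Y i w * Y j w)%:E)))%E.
  apply: eq_integral => w _.
  have -> : (\sum_(i < M) \sum_(j < M) (Y i w * Y j w)%:E =
      (\sum_(i < M) \sum_(j < M) Y i w * Y j w)%R%:E)%E.
    by rewrite -sumEFin; apply: eq_bigr => i _; rewrite sumEFin.
  rewrite -EFinM; congr EFin.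
  under [in RHS]eq_bigr do rewrite -mulr_sumr.
  rewrite -mulr_suml -expr2 -exprVn -exprMn -sqrrN; congr (_ ^+ 2).
  rewrite sumrB sumr_const card_ord mulrBr -[m *+ M]mulr_natl mulKf//; ring.
rewrite integralZl//; last first.
  apply: integrable_sum => // i _; apply: integrable_sum => // j _; exact: iY2.
rewrite integral_sum//; last first.
  move=> i; apply: integrable_sum => // j _; exact: iY2.
have -> : (V / M%:R)%:E = ((M%:R ^-2)%:E * (\sum_(i < M) V%:E))%E.
  rewrite sumEFin -EFinM sumr_const card_ord -[V *+ M]mulr_natl; congr EFin; field.
  exact: Mn0.
apply: lee_wpmul2l; first by rewrite lee_fin invr_ge0 exprn_ge0.
apply: lee_sum => i _.
rewrite integral_sum//; last by move=> j; exact: iY2.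
rewrite (bigD1 i)//= big1 ?adde0 ?EY2//.
by move=> j ji; apply: EYY; rewrite eq_sym.
Qed.

End UniformSamples.

(** * The resolvent of a dilation *)

Section RealDilation.
Context {R : realType}.
Local Notation mu := (@lebesgue_measure R).
Local Notation mu2 := (@lebesgue_measure R \x @lebesgue_measure R)%E.
Implicit Types u D : R * R -> R.

(** These sets are compact, have finite measure, exhaust the plane and are mapped into themselves by
    every ratio in [[0, 1]]; being products of intervals, they are measurable for the product
    sigma-algebra. *)
Definition square_box (r : R) : set (R * R) :=
  `[- r, r]%classic `*` `[- r, r]%classic.

(** Real counterpart of [locally_bounded], for one coordinate of the estimator. *)
Definition bounded_around u : Prop :=
  forall w0 : R * R, exists B : R, \forall w \near w0, `|u w| <= B.

Lemma continuous_plane_scale u (s : R) : continuous u ->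
  continuous (fun w => u (s * w.1, s * w.2)).
Proof.
move=> cu w; apply: (@continuous_comp _ _ _ (fun w => (s * w.1, s * w.2)) u); last exact: cu.
have h1 : s * w'.1 @[w' --> w] --> s * w.1 by apply: cvgMr; exact: cvg_fst.
have h2 : s * w'.2 @[w' --> w] --> s * w.2 by apply: cvgMr; exact: cvg_snd.
exact: (cvg_pair h1 h2).
Qed.

Lemma compact_square_box (r : R) : compact (square_box r).
Proof. by apply: compact_setX; exact: segment_compact. Qed.

Lemma bounded_around_square_box u (r : R) : bounded_around u ->
  exists2 B : R, 0 <= B & forall w, square_box r w -> `|u w| <= B.
Proof.
move=> bu.
have /compact_near_coveringP/near_covering_withinP := @compact_square_box r.
move=> /(_ R +oo (fun B w => `|u w| <= B)) H.
have : \forall B \near +oo, square_box r `<=` (fun w => `|u w| <= B).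
  apply: H => w _; have [B HB] := bu w.
  near=> w' B' => /= _.
  apply: (@le_trans _ _ B); last by near: B'; apply: nbhs_pinfty_ge; exact: num_real.
  by near: w'.
move=> [N [Nr NB]]; exists (Num.max 0 N + 1).
  by rewrite addr_ge0// le_max lexx.
move=> w ww; apply: NB => //.
by rewrite (@le_lt_trans _ _ (Num.max 0 N))// ?le_max ?lexx ?orbT// ltrDl.
Unshelve. all: by end_near. Qed.

Lemma continuous_bounded_around u : continuous u -> bounded_around u.
Proof.
move=> cu w0; exists (`|u w0| + 1).
have /cvgrPdist_le/(_ 1 ltr01) := cu w0.
apply: filterS => w; rewrite distrC => H.
rewrite -lerBlDl; apply: le_trans H.
exact: lerB_dist.
Qed.

Definition real_dilation (c : R) u : R * R -> R :=
  fun w => c ^+ 4 * u (c * w.1, c * w.2).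

Lemma iter_real_dilationE c u n w :
  iter n (real_dilation c) u w = (c ^+ n) ^+ 4 * u (c ^+ n * w.1, c ^+ n * w.2).
Proof.
elim: n w => [|n IH] w; first by rewrite expr0 expr1n !mul1r; case: w.
rewrite iterS {1}/real_dilation IH/= [c ^+ n.+1]exprS.
by move: (c ^+ n) => q; rewrite mulrA; congr (_ * u (_, _)); ring.
Qed.

Lemma square_box_scale (c r : R) w : 0 <= c <= 1 -> square_box r w ->
  square_box r (c * w.1, c * w.2).
Proof.
move=> /andP[c0 c1] [/=]; rewrite !in_itv/= => /andP[a1 a2] /andP[b1 b2].
by split; rewrite /= in_itv/=; apply/andP; split; nra.
Qed.

Lemma mem_square_box w : square_box (Num.max `|w.1| `|w.2|) w.
Proof.
by split; rewrite /= in_itv/= -ler_norml le_max lexx ?orbT.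
Qed.

(** Sum of the Neumann series. Contractions keep the points in a fixed box, where [D] is bounded by
    some [B]; the weight [c ^+ (4 * n)] is bounded crudely by [c ^+ n], which dominates the series
    by a geometric one and bounds its sum by [B / (1 - c)] on the box. *)
Lemma resolvent_dilation_exists (c : R) D : 0 < c < 1 -> continuous D ->
  exists u, bounded_around u /\ forall w, u w - real_dilation c u w = D w.
Proof.
move=> /andP[c0 c1] cD.
have c01 : 0 <= c <= 1 by rewrite !ltW.
pose t w (n : nat) := iter n (real_dilation c) D w.
have cn n : 0 <= c ^+ n <= 1 by rewrite exprn_ge0 ?exprn_ile1// ltW.
have tB r B : 0 <= B -> (forall w, square_box r w -> `|D w| <= B) ->
    forall w, square_box r w -> forall n, `|t w n| <= geometric B c n.
  move=> B0 DB w rw n; rewrite /t iter_real_dilationE normrM.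
  rewrite /= mulrC ler_pM//; first exact/DB/square_box_scale.
  have /andP[cn0 cn1] := cn n.
  rewrite ger0_norm; last by rewrite exprn_ge0.
  rewrite (_ : c ^+ n ^+ 4 = c ^+ n * (c ^+ n) ^+ 3); last by rewrite -exprS.
  by rewrite ler_piMr// exprn_ile1.
have tcvg w : cvgn (series (t w)).
  have [B B0 DB] := bounded_around_square_box (Num.max `|w.1| `|w.2|)
    (continuous_bounded_around cD).
  apply: normed_cvg; apply: (@series_le_cvg _ _ (geometric B c)) => [n|n|n|].
  - exact: normr_ge0.
  - by rewrite /= mulr_ge0// exprn_ge0// ltW.
  - exact: (tB _ _ B0 DB _ (mem_square_box w)).
  - by apply: is_cvg_geometric_series; rewrite ger0_norm// ltW.
have c_lt1 : `|c| < 1 by rewrite ger0_norm// ltW.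
exists (fun w => limn (series (t w))); split.
- move=> w0; pose r := Num.max `|w0.1| `|w0.2| + 1.
  have [B B0 DB] := bounded_around_square_box r (continuous_bounded_around cD).
  exists (B * (1 - c)^-1).
  have nearbox : \forall w \near w0, square_box r w.
    apply/nbhs_ballP; exists 1 => //= -[x y] [/= bx by_].
    move: bx by_; rewrite /ball/= => bx by_.
    have := ler_normB w0.1 (w0.1 - x); have := ler_normB w0.2 (w0.2 - y).
    rewrite !subKr => ny nx.
    have mx : `|w0.1| <= Num.max `|w0.1| `|w0.2| by rewrite le_max lexx.
    have my : `|w0.2| <= Num.max `|w0.1| `|w0.2| by rewrite le_max lexx orbT.
    by split; rewrite /= in_itv/= -ler_norml /r; lra.
  apply: filterS nearbox => w rw.
  have part N : `|series (t w) N| <= B * (1 - c)^-1.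
    apply: le_trans (geometric_le_lim N B0 c0 c_lt1).
    by apply: le_trans (ler_norm_sum _ _ _) _; apply: ler_sum => n _; exact: tB rw n.
  have nc : `|series (t w) N| @[N --> \oo] --> `|limn (series (t w))|.
    exact: cvg_norm (tcvg w).
  rewrite -(cvg_lim _ nc)//; apply: limr_le; first by apply/cvg_ex; eexists; exact: nc.
  by near=> N; exact: part.
- move=> w; apply/eqP; rewrite subr_eq; apply/eqP.
  (* Without its first term the series at [w] is the dilation of the series at [c w]; passing to the
     limit gives the equation. *)
  have E N : series (t w) N.+1 = D w + c ^+ 4 * series (t (c * w.1, c * w.2)) N.
    rewrite /series/= big_nat_recl//; congr (_ + _).
    by rewrite mulr_sumr; apply: eq_bigr.
  have L1 : series (t w) N.+1 @[N --> \oo] --> limn (series (t w)).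
    by rewrite (cvg_shiftS (series (t w))); exact: tcvg.
  have L2 : series (t w) N.+1 @[N --> \oo] -->
      D w + c ^+ 4 * limn (series (t (c * w.1, c * w.2))).
    under eq_fun do rewrite E.
    by apply: cvgD; [exact: cvg_cst|apply: cvgMr; exact: tcvg].
  by rewrite /real_dilation; apply: cvg_unique L1 L2.
Unshelve. all: by end_near. Qed.

Lemma measurable_square_box r :
  measurable (square_box r : set (measurableTypeR R * measurableTypeR R)).
Proof. by apply: measurableX; exact: measurable_itv. Qed.

Lemma square_box_lty r : (mu2 (square_box r) < +oo)%E.
Proof.
have -> : (mu2 (square_box r) = mu `[(- r)%R, r]%classic * mu `[(- r)%R, r]%classic)%E.
  by apply: product_measure1E; exact: measurable_itv.
rewrite !lebesgue_measure_itv/=.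
by case: ifP => _; rewrite ?mule0 -?EFinD -?EFinM ltry.
Qed.

Lemma sigma_finite_plane : sigma_finite setT mu2.
Proof.
exists (fun n => square_box n%:R); last first.
  by move=> n; split; [exact: measurable_square_box|exact: square_box_lty].
apply/seteqP; split=> // w _; have [n wn] : exists n, Num.max `|w.1| `|w.2| <= n%:R.
  exists (Num.bound (Num.max `|w.1| `|w.2|)); apply: ltW; apply: archi_boundP.
  by rewrite le_max normr_ge0.
exists n => //; move: wn; rewrite ge_max => /andP[h1 h2].
by split; rewrite /= in_itv/= -ler_norml.
Qed.

(** By telescoping, the partial Neumann sums equal [u - L_c^N u], and [L_c^N u] tends to 0 pointwise
    because [u] is bounded on a box. Hence every locally bounded solution is a pointwise limit of
    continuous functions. *)
Lemma measurable_resolvent (c : R) u D : 0 < c < 1 -> continuous D ->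
  bounded_around u -> (forall w, u w - real_dilation c u w = D w) ->
  measurable_fun [set: measurableTypeR R * measurableTypeR R] u.
Proof.
move=> /andP[c0 c1] cD bu uD.
have c01 : 0 <= c <= 1 by rewrite !ltW.
apply: (@measurable_fun_cvg _ _ _ _ (fun N w =>
  \sum_(0 <= n < N) iter n (real_dilation c) D w)) => //.
  move=> N; apply: measurable_sum => n.
  apply: (eq_measurable_fun (fun w => (c ^+ n) ^+ 4 * D (c ^+ n * w.1, c ^+ n * w.2))).
    by move=> w _; rewrite iter_real_dilationE.
  have cDn := continuous_plane_scale (s := c ^+ n) cD.
  by apply: measurable_funM => //; exact: continuous_plane_measurable cDn.
move=> w _.
have sumE N : \sum_(0 <= n < N) iter n (real_dilation c) D w =
    u w - iter N (real_dilation c) u w.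
  elim: N => [|N IH]; first by rewrite big_nil subrr.
  rewrite big_nat_recr//= -iterS IH !iter_real_dilationE -uD /real_dilation/=.
  by rewrite [c ^+ N.+1]exprS !mulrA exprMn; ring.
under eq_fun do rewrite sumE.
suff it0 : iter N (real_dilation c) u w @[N --> \oo] --> (0 : R).
  have cu : u w @[_ --> \oo] --> (u w : R) by exact: cvg_cst.
  have := cvgB cu it0; rewrite subr0 => H; exact: H.
have [B B0 uB] := bounded_around_square_box (Num.max `|w.1| `|w.2|) bu.
apply/cvgr0Pnorm_le => e e0.
have : (fun N => B * c ^+ N) @ \oo --> (0 : R).
  rewrite -(mulr0 B); apply: cvgMr; apply: cvg_expr.
  by rewrite ger0_norm// ltW.
move=> /cvgr0Pnorm_le/(_ e e0); apply: filterS => N HN.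
apply: le_trans HN; rewrite iter_real_dilationE !normrM mulrC (ger0_norm B0).
have cN : 0 <= c ^+ N <= 1 by rewrite exprn_ge0 ?exprn_ile1// ltW.
rewrite ler_pM//; first exact/uB/square_box_scale/mem_square_box.
have /andP[cN0 cN1] := cN.
by rewrite !(ger0_norm cN0) ler_piMr// mulr_ile1 ?mulr_ge0// mulr_ile1.
Qed.

(* Young's inequality with weights [c ^+ 3] and [1 - c ^+ 3] turns the equation into
   the pointwise bound [u ^+ 2 <= (real_dilation c u) ^+ 2 / c ^+ 3 + D ^+ 2 / (1 - c ^+ 3)];
   on a square box the dilated term is absorbed because there [u] is bounded. *)
Lemma resolvent_dilation_energy (c : R) u D : 0 < c < 1 -> continuous D ->
  bounded_around u -> (forall w, u w - real_dilation c u w = D w) ->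
  (\int[mu2]_w ((u w) ^+ 2)%:E <=
   ((1 - c ^+ 3) ^- 2)%:E * \int[mu2]_w ((D w) ^+ 2)%:E)%E.
Proof.
move=> /andP[c0 c1] cD bu uD.
have c01 : 0 <= c <= 1 by rewrite !ltW.
have c3 : 0 < c ^+ 3 < 1 by rewrite exprn_gt0//= exprn_ilt1// ltW.
have mu_ := measurable_resolvent (introT andP (conj c0 c1)) cD bu uD.
have mD : measurable_fun [set: measurableTypeR R * measurableTypeR R] D.
  exact: continuous_plane_measurable.
pose box r : set (measurableTypeR R * measurableTypeR R) := square_box r.
have mbox r : measurable (box r) by exact: measurable_square_box.
pose v r w : R := u w ^+ 2 * \1_(box r) w.
have mv r : measurable_fun [set: measurableTypeR R * measurableTypeR R] (v r).
  by apply: measurable_funM; [exact: measurable_funX|exact: measurable_indic].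
have v0 r w : 0 <= v r w by rewrite mulr_ge0// sqr_ge0.
have c3' : 0 < 1 - c ^+ 3 by lra.
have c3p : 0 < c ^+ 3 by lra.
have J0 : (0 <= \int[mu2]_w ((D w) ^+ 2)%:E)%E.
  by apply: integral_ge0 => w _; rewrite lee_fin sqr_ge0.
have mD2 : measurable_fun [set: measurableTypeR R * measurableTypeR R]
    (fun w => ((D w) ^+ 2)%:E).
  by apply/measurable_EFinP; exact: measurable_funX.
have boxed r : (\int[mu2]_w (v r w)%:E <=
    ((1 - c ^+ 3) ^- 2)%:E * \int[mu2]_w ((D w) ^+ 2)%:E)%E.
  have [B B0 uB] := bounded_around_square_box r bu.
  have Ifin : (\int[mu2]_w (v r w)%:E < +oo)%E.
    apply: (@le_lt_trans _ _ (\int[mu2]_w ((B ^+ 2)%:E * (\1_(box r) w)%:E))%E).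
      apply: ge0_le_integral => //.
      - by move=> w _; rewrite lee_fin.
      - exact/measurable_EFinP.
      - by apply/measurable_EFinP; apply: measurable_funM => //; exact: measurable_indic.
      - move=> w _; rewrite lee_fin /v indicE.
        have [|_] := boolP (w \in box r); last by rewrite !mulr0.
        by rewrite inE => /uB ub; rewrite !mulr1 -real_normK ?num_real// lerXn2r// nnegrE.
    rewrite ge0_integralZl//; last 2 first.
    - by apply/measurable_EFinP; exact: measurable_indic.
    - by rewrite lee_fin sqr_ge0.
    rewrite integral_indic// setIT.
    rewrite lte_mul_pinfty ?lee_fin ?sqr_ge0//; exact: square_box_lty.
  have mvc : measurable_fun [set: measurableTypeR R * measurableTypeR R]
      (fun w => v r (c * w.1, c * w.2)).
    apply: (measurableT_comp (mv r)).
    by apply: measurable_fun_pair; exact: measurable_funM.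
  have step : (\int[mu2]_w (v r w)%:E <= (c ^+ 3)%:E * \int[mu2]_w (v r w)%:E +
      ((1 - c ^+ 3)^-1)%:E * \int[mu2]_w ((D w) ^+ 2)%:E)%E.
    (* The exponent 5 is 8 minus 3: the squared weight [c ^+ 8] divided by the Young weight
       [c ^+ 3]. The Jacobian brings it down to 3. *)
    have -> : ((c ^+ 3)%:E * \int[mu2]_w (v r w)%:E =
        \int[mu2]_w ((c ^+ 5)%:E * (v r (c * w.1, c * w.2))%:E))%E.
      rewrite ge0_integralZl//; last 3 first.
      - exact/measurable_EFinP.
      - by move=> w _; rewrite lee_fin.
      - by rewrite lee_fin exprn_ge0// ltW.
      rewrite (ge0_integral_plane_scale (g := fun w => (v r w)%:E));
        [|by []|exact/measurable_EFinP|by move=> w; rewrite lee_fin].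
      rewrite muleA -EFinM; congr (_%:E * _)%E.
      by field; rewrite gt_eqF.
    rewrite -ge0_integralZl//; last 2 first.
    - by move=> w _; rewrite lee_fin sqr_ge0.
    - by rewrite lee_fin invr_ge0 ltW.
    rewrite -ge0_integralD//; last 4 first.
    - by move=> w _; rewrite mule_ge0// lee_fin// exprn_ge0// ltW.
    - by apply/measurable_EFinP; exact: measurable_funM.
    - by move=> w _; rewrite mule_ge0// lee_fin ?sqr_ge0// invr_ge0 ltW.
    - by apply/measurable_EFinP; apply: measurable_funM => //; exact: measurable_funX.
    apply: ge0_le_integral => //.
    - by move=> w _; rewrite lee_fin.
    - exact/measurable_EFinP.
    - apply/measurable_EFinP; apply: measurable_funD; apply: measurable_funM => //.
      exact: measurable_funX.
    move=> w _; rewrite -!EFinM -EFinD lee_fin.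
    apply: (@le_trans _ _ ((real_dilation c u w) ^+ 2 / c ^+ 3 * \1_(box r) w +
        (1 - c ^+ 3)^-1 * D w ^+ 2)).
      rewrite /v indicE; have [_|_] := boolP (w \in box r); last first.
        by rewrite !mulr0 add0r mulr_ge0 ?sqr_ge0// invr_ge0 ltW.
      rewrite !mulr1 -(uD w).
      set U := u w; set L := real_dilation c u w; rewrite -subr_ge0.
      rewrite (_ : _ - _ = (U * c ^+ 3 - L) ^+ 2 / (c ^+ 3 * (1 - c ^+ 3))); last first.
        by field; rewrite !gt_eqF.
      by apply: divr_ge0; [exact: sqr_ge0|apply: mulr_ge0; exact: ltW].
    rewrite lerD2r /v /real_dilation.
    (* The truncation passes to the dilated argument since the box is stable under the
       contraction. *)
    have wbox : \1_(box r) w <= \1_(box r) (c * w.1, c * w.2) :> R.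
      rewrite !indicE; have [|_] := boolP (w \in box r); last by rewrite ler0n.
      by rewrite inE => rw; rewrite mem_set//; exact: square_box_scale.
    rewrite [leLHS](_ : _ = c ^+ 5 * (u (c * w.1, c * w.2) ^+ 2 * \1_(box r) w)); last first.
      by field; rewrite gt_eqF.
    by rewrite ler_wpM2l ?exprn_ge0 ?(ltW c0)// ler_wpM2l ?sqr_ge0.
  have Ige0 : (0 <= \int[mu2]_w (v r w)%:E)%E by apply: integral_ge0 => w _; rewrite lee_fin.
  move: step Ifin Ige0; case: (\int[mu2]_w (v r w)%:E)%E => // i.
  move: J0; case: (\int[mu2]_w ((D w) ^+ 2)%:E)%E => // [j j0|_ _ _ _]; last first.
    by rewrite gt0_muley ?leey// lte_fin invr_gt0 exprn_gt0.
  rewrite -!EFinM -EFinD !lee_fin => H _ _.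
  have : i * (1 - c ^+ 3) <= (1 - c ^+ 3)^-1 * j by lra.
  rewrite -ler_pdivlMr// => /le_trans; apply.
  by rewrite le_eqVlt; apply/orP; left; apply/eqP; field; rewrite gt_eqF.
(* The bound on a box does not depend on its size, so monotone convergence extends it to the
   plane. *)
pose g (n : nat) w := (v n%:R w)%:E.
have gmono n m w : (n <= m)%N -> (g n w <= g m w)%E.
  move=> nm; rewrite lee_fin ler_wpM2l ?sqr_ge0// !indicE.
  have [|_] := boolP (w \in box n%:R); last by rewrite ler0n.
  rewrite inE => -[/=]; rewrite !in_itv/= => h1 h2; rewrite mem_set//.
  have nmR : n%:R <= m%:R :> R by rewrite ler_nat.
  by split; rewrite /= in_itv/=; lra.
have -> : (\int[mu2]_w ((u w) ^+ 2)%:E = \int[mu2]_w limn (g ^~ w))%E.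
  apply: eq_integral => w _; apply/esym/cvg_lim => //.
  apply: (@cvg_trans _ ((fun=> (u w ^+ 2)%:E) @ \oo)); last exact: cvg_cst.
  apply: near_eq_cvg; near=> n.
  rewrite /g /v indicE mem_set ?mulr1//.
  have : Num.max `|w.1| `|w.2| <= n%:R by near: n; exact: nbhs_infty_ger.
  rewrite ge_max => /andP[h1 h2].
  by split; rewrite /= in_itv/= -ler_norml.
rewrite monotone_convergence//; last 3 first.
- by move=> n; exact/measurable_EFinP.
- by move=> n w _; rewrite lee_fin.
- by move=> w _ n m nm; exact: gmono.
apply: lime_le; last by near=> n; exact: boxed.
apply: ereal_nondecreasing_is_cvgn => n m nm; apply: ge0_le_integral => //.
- by move=> w _; rewrite lee_fin.
- exact/measurable_EFinP.
- exact/measurable_EFinP.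
- by move=> w _; exact: gmono.
Unshelve. all: by end_near. Qed.

End RealDilation.

(** * Bispectra of dilated and translated signals *)

Section Spectra.
Context {R : realType}.
Local Notation mu := (@lebesgue_measure R).
Local Open Scope complex_scope.

(** A union of uncountably many open sets on which [g] vanishes almost everywhere needs a Lindelof
    argument: each of its points lies in a rational interval inside one such open set, and the
    rational intervals, enumerated by [unpickle], contribute countably many null sets. *)
Lemma ess_support_ae_eq0 (g : R -> R) (a b : R) :
  ess_support g `<=` `[a, b]%classic ->
  {ae mu, forall x, x \notin `[a, b] -> g x = 0}.
Proof.
move=> gab.
pose good (U : set R) := open U /\ {ae mu, forall x, U x -> g x = 0}.
pose W (pq : rat * rat) : set R :=
  [set x | ratr pq.1 < x < ratr pq.2 /\
    exists U, good U /\ `]ratr pq.1, ratr pq.2[%classic `<=` U].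
pose N (n : nat) : set R :=
  if (unpickle n : option (rat * rat)) is Some pq then [set x | W pq x /\ g x != 0]
  else set0.
have /(negligibleS _) : mu.-negligible (\bigcup_n N n).
  apply: negligible_bigcup => n; rewrite /N.
  case: (unpickle n) => [pq|]; last exact: negligible_set0.
  have [[U [[oU gU] pqU]]|noU] := pselect (exists U, good U /\
      `]ratr pq.1, ratr pq.2[%classic `<=` U).
    apply: negligibleS gU => x [[xpq _] gx] /= H.
    by move: gx; rewrite H ?eqxx//; apply: pqU; rewrite /= in_itv.
  by apply: negligibleS (negligible_set0 _) => x [[_ /noU]].
apply => x /= /not_implyP[xab gx].
have [U [oU gU] Ux] : (\bigcup_(U in good) U) x.
  apply: contrapT => nU; move: xab; apply/negP; rewrite negbK.
  by have := gab x nU.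
have /nbhs_ballP[e /= e0 eU] : nbhs x U by exact: open_nbhs_nbhs.
have /rat_in_itvoo[p /itvP pP] : x - e < x by lra.
have /rat_in_itvoo[q /itvP qP] : x < x + e by lra.
exists (pickle (p, q)); first exact: I.
rewrite /N pickleK; split; last exact/eqP.
split=> /=; first by rewrite pP qP.
exists U; split=> // y /=; rewrite in_itv/= => /andP[py yq]; apply: eU.
have qe : ratr q < x + e by rewrite qP.
have pe : x - e < ratr p by rewrite pP.
by rewrite /ball/= ltr_norml; apply/andP; split; lra.
Qed.

Lemma observation_affine (f : R -> R) (t tau : R) :
  observation f t tau = (fun x => f ((1 - tau)^-1 * x + - ((1 - tau)^-1 * t))).
Proof. by apply/funext => x; rewrite /observation mulrBr. Qed.

(** On a bounded support L^2 is contained in L^1, through [|z| <= 1 + z ^+ 2]. This applies to the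
    observation, and an affine substitution carries integrability back to [f]. *)
Lemma observation_integrable (f : R -> R) (t tau a b : R) : 0 < 1 - tau ->
  f \in Lfun mu 2%:E ->
  ess_support (observation f t tau) `<=` `[a, b]%classic ->
  mu.-integrable setT (EFin \o f).
Proof.
move=> s0 fL2 supp.
have i0 : 0 < (1 - tau)^-1 by rewrite invr_gt0.
have mf : measurable_fun [set: R] f.
  by move: fL2; rewrite inE => /andP[]; rewrite inE.
have f2 := Lfun2_integrable_sqr fL2.
apply/(integrable_affine (- ((1 - tau)^-1 * t)) i0 mf).
rewrite -observation_affine; set g := observation f t tau in supp *.
have g2 : mu.-integrable setT (EFin \o (fun x => g x ^+ 2)).
  rewrite /g observation_affine.
  apply/(integrable_affine (f := fun x => f x ^+ 2) (- ((1 - tau)^-1 * t)) i0) => //.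
  exact: measurable_funX.
have mg : measurable_fun [set: R] g.
  rewrite /g observation_affine; apply: (measurableT_comp mf).
  by apply: measurable_funD => //; exact: measurable_funM.
apply/integrableP; split; first exact/measurable_EFinP.
apply: (@le_lt_trans _ _ (\int[mu]_x ((\1_`[a, b]%classic x)%:E + (g x ^+ 2)%:E))%E).
  apply: ae_ge0_le_integral => //.
  - by apply: measurableT_comp => //; exact/measurable_EFinP.
  - by move=> x _; rewrite -EFinD lee_fin addr_ge0 ?sqr_ge0.
  - apply/measurable_EFinP; apply: measurable_funD; last exact: measurable_funX.
    exact: measurable_indic.
  - apply: negligibleS (ess_support_ae_eq0 supp) => x /= nH H; apply: nH => _.
    rewrite -EFinD lee_fin indicE.
    have [xab|/H ->] := boolP (x \in `[a, b]); last by rewrite normr0 expr0n addr0.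
    rewrite mem_set//.
    have : 0 <= (`|g x| - 1) ^+ 2 by rewrite sqr_ge0.
    rewrite -[g x ^+ 2]real_normK ?num_real//=.
    have := normr_ge0 (g x).
    move: `|g x| => z; nra.
rewrite ge0_integralD//; last 3 first.
- by apply/measurable_EFinP; exact: measurable_indic.
- by move=> x _; rewrite lee_fin sqr_ge0.
- by apply/measurable_EFinP; exact: measurable_funX.
rewrite lte_add_pinfty//.
  rewrite integral_indic//= setIT lebesgue_measure_itv/=.
  by case: ifP => // _; rewrite ?ltry// -EFinD ltry.
move/integrableP : g2 => [_]; apply: le_lt_trans.
rewrite le_eqVlt; apply/orP; left; apply/eqP; apply: eq_integral => x _ /=.
by rewrite ger0_norm// sqr_ge0.
Qed.

Lemma integrableM_bounded (f h : R -> R) (B : R) :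
  mu.-integrable setT (EFin \o f) -> measurable_fun [set: R] h ->
  (forall x, `|h x| <= B) -> mu.-integrable setT (EFin \o (fun x => f x * h x)).
Proof.
move=> fi mh hB.
have mf : measurable_fun [set: R] f by move/integrableP: fi => [/measurable_EFinP].
refine (@le_integrable _ (measurableTypeR R) R mu setT measurableT _
  (fun x => (B%:E * (f x)%:E)%E) _ _ _).
- by apply/measurable_EFinP; exact: measurable_funM.
- move=> x _; rewrite -EFinM lee_fin !normrM mulrC ler_wpM2r//.
  by apply: le_trans (hB x) _; exact: ler_norm.
- exact: integrableZl.
Qed.

Lemma cisD (x y : R) : cis (x + y) = cis x * cis y.
Proof. by rewrite /cis; simpc; rewrite cosD sinD; congr (_ +i* _); ring. Qed.

(** Substitution [x = s * y + t]. It is carried out on cosine and sine integrals because [Cintegral]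
    is defined by coordinates; integrability of [f] allows the addition formulas to be integrated
    term by term. *)
Lemma fourier_observation (f : R -> R) (t tau w : R) : 0 < 1 - tau ->
  mu.-integrable setT (EFin \o f) ->
  fourier (observation f t tau) w =
  (1 - tau)%:C * cis (- (w * t)) * fourier f ((1 - tau) * w).
Proof.
move=> s0 fi; set s := 1 - tau in s0 *.
have i0 : 0 < s^-1 by rewrite invr_gt0.
have sn0 : s != 0 by rewrite gt_eqF.
have mcos (v : R) : measurable_fun [set: R] (fun x => cos (- (v * x))).
  apply: measurableT_comp; first by apply: continuous_measurable_fun; exact: continuous_cos.
  by apply: measurableT_comp => //; exact: measurable_funM.
have msin (v : R) : measurable_fun [set: R] (fun x => sin (- (v * x))).
  apply: measurableT_comp; first by apply: continuous_measurable_fun; exact: continuous_sin.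
  by apply: measurableT_comp => //; exact: measurable_funM.
have cos1 x : `|cos x : R| <= 1 by rewrite ler_norml cos_geN1 cos_le1.
have sin1 x : `|sin x : R| <= 1 by rewrite ler_norml sin_geN1 sin_le1.
have ic v := integrableM_bounded fi (mcos v) (fun x => cos1 _).
have is_ v := integrableM_bounded fi (msin v) (fun x => sin1 _).
have FE g v : fourier g v = Rintegral mu setT (fun x => g x * cos (- (v * x))) +i*
    Rintegral mu setT (fun x => g x * sin (- (v * x))).
  rewrite /fourier /Cintegral; congr (_ +i* _); apply: eq_Rintegral => x _;
    by rewrite /cis/=; ring.
have argE x : - (w * x) = - (s * w * (s^-1 * x + - (s^-1 * t))) + - (w * t).
  by field.
set A := Rintegral mu setT (fun x => f x * cos (- (s * w * x))).
set B := Rintegral mu setT (fun x => f x * sin (- (s * w * x))).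
have Ccos : Rintegral mu setT (fun x => observation f t tau x * cos (- (w * x))) =
    s * (A * cos (- (w * t)) - B * sin (- (w * t))).
  pose q y := f y * cos (- (s * w * y)) * cos (- (w * t)) -
    f y * sin (- (s * w * y)) * sin (- (w * t)).
  rewrite (_ : (fun x => _) = (fun x => q (s^-1 * x + - (s^-1 * t)))); last first.
    by apply/funext => x; rewrite observation_affine argE cosD /q -/s; ring.
  have i1 : mu.-integrable setT (EFin \o (fun y => f y * cos (- (s * w * y)) * cos (- (w * t)))).
    exact: (integrableM_bounded (ic (s * w)) (measurable_cst _) (fun=> cos1 _)).
  have i2 : mu.-integrable setT (EFin \o (fun y => f y * sin (- (s * w * y)) * sin (- (w * t)))).
    exact: (integrableM_bounded (is_ (s * w)) (measurable_cst _) (fun=> sin1 _)).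
  rewrite Rintegral_affine ?invrK//; last first.
    exact: (integrableB measurableT i1 i2).
  by rewrite RintegralB// !RintegralZr.
have Csin : Rintegral mu setT (fun x => observation f t tau x * sin (- (w * x))) =
    s * (B * cos (- (w * t)) + A * sin (- (w * t))).
  pose q y := f y * sin (- (s * w * y)) * cos (- (w * t)) +
    f y * cos (- (s * w * y)) * sin (- (w * t)).
  rewrite (_ : (fun x => _) = (fun x => q (s^-1 * x + - (s^-1 * t)))); last first.
    by apply/funext => x; rewrite observation_affine argE sinD /q -/s; ring.
  have i1 : mu.-integrable setT (EFin \o (fun y => f y * sin (- (s * w * y)) * cos (- (w * t)))).
    exact: (integrableM_bounded (is_ (s * w)) (measurable_cst _) (fun=> cos1 _)).
  have i2 : mu.-integrable setT (EFin \o (fun y => f y * cos (- (s * w * y)) * sin (- (w * t)))).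
    exact: (integrableM_bounded (ic (s * w)) (measurable_cst _) (fun=> sin1 _)).
  rewrite Rintegral_affine ?invrK//; last first.
    exact: (integrableD measurableT i1 i2).
  by rewrite RintegralD// !RintegralZr.
rewrite !FE Ccos Csin -/A -/B /cis; simpc; congr (_ +i* _); ring.
Qed.

Lemma bispectrum_observation (f : R -> R) (t tau : R) (w : R * R) : 0 < 1 - tau ->
  mu.-integrable setT (EFin \o f) ->
  bispectrum (observation f t tau) w =
  ((1 - tau) ^+ 3)%:C * bispectrum f ((1 - tau) * w.1, (1 - tau) * w.2).
Proof.
move=> s0 fi; rewrite /bispectrum !fourier_observation// -mulrBr.
set s := 1 - tau; set F1 := fourier f _; set F2 := fourier f _; set F3 := fourier f _.
have cisJ x : conjc (cis x) = cis (- x) :> R[i] by rewrite /cis cosN sinN.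
have realJ x : conjc (x%:C) = x%:C :> R[i] by apply/eqP; rewrite eq_complex /= oppr0 !eqxx.
have conjM (x y : R[i]) : conjc (x * y) = conjc x * conjc y by exact: rmorphM.
have conjE (z : R[i]) : Num.conj z = conjc z by [].
rewrite conjE !conjM realJ cisJ opprK rmorphXn.
(* The three signed frequencies [w.1], [- w.2] and [w.2 - w.1] add up to zero. *)
have phase : cis (- (w.1 * t)) * cis (w.2 * t) * cis (- ((w.2 - w.1) * t)) = 1 :> R[i].
  rewrite -!cisD (_ : _ + _ = 0); last by ring.
  by rewrite /cis cos0 sin0.
transitivity (s%:C ^+ 3 * (F1 * conjc F2 * F3) *
  (cis (- (w.1 * t)) * cis (w.2 * t) * cis (- ((w.2 - w.1) * t)))); last by rewrite phase mulr1.
by ring.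
Qed.

End Spectra.

(** * The deviation of the sample mean *)

Section RealCore.
Context {R : realType}.
Local Notation mu := (@lebesgue_measure R).
Local Notation mu2 := (@lebesgue_measure R \x @lebesgue_measure R)%E.
Implicit Types G : R * R -> R.

Section PlaneTonelli.
Context {d : measure_display} {T : measurableType d}.
Variable P : {sigma_finite_measure set T -> \bar R}.
Variable F : (measurableTypeR R * measurableTypeR R) * T -> \bar R.
Hypothesis mF : measurable_fun setT F.
Hypothesis F0 : forall z, (0 <= F z)%E.

(* [mu2] carries no canonical sigma-finite structure. *)
Let plane : {sigma_finite_measure set (measurableTypeR R * measurableTypeR R)%type -> \bar R} :=
  HB.pack mu2 (Measure_isSigmaFinite.Build _ _ _ mu2 (@sigma_finite_plane R)).

Lemma plane_tonelli :
  (\int[mu2]_x \int[P]_w F (x, w) = \int[P]_w \int[mu2]_x F (x, w))%E.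
Proof. exact: (@fubini_tonelli _ _ _ _ _ plane P F mF F0). Qed.

Lemma measurable_plane_tonelli1 : measurable_fun setT (fun x => \int[P]_w F (x, w))%E.
Proof. exact: (@measurable_fun_fubini_tonelli_F _ _ _ _ _ P F). Qed.

Lemma measurable_plane_tonelli2 : measurable_fun setT (fun w => \int[mu2]_x F (x, w))%E.
Proof. exact: (@measurable_fun_fubini_tonelli_G _ _ _ _ _ plane F). Qed.

End PlaneTonelli.

(** For positive [n], the factor of [v ^+ n.-1] in the derivative of [v ^+ n * G (v x)], evaluated
    at [v x]. The case [n = 4] produces [H] from a coordinate of [Bf], and [n = 3] is then applied
    to [H]. *)
Definition radial_density n G : R * R -> R := fun w => n%:R * G w + euler G w.

Lemma Ck_radial_density k n G : Ck k.+1 G -> Ck k (radial_density n G).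
Proof.
move=> CG; apply: CkD; last exact: Ck_euler.
by apply: CkM; [exact: Ck_cst|exact: CkS].
Qed.

Lemma euler_radial_density n G w : Ck 2 G ->
  euler (radial_density n G) w = n%:R * euler G w + euler (euler G) w.
Proof.
move=> CG; have [_ [g1 g2 _ _]] := CG; have [_ [e1 e2 _ _]] := Ck_euler CG.
have D (v : R * R) : derivable G w v -> derivable (euler G) w v ->
    'D_v (radial_density n G) w = n%:R * 'D_v G w + 'D_v (euler G) w.
  move=> dG dE.
  have -> : radial_density n G = n%:R \*: G + euler G by [].
  by rewrite deriveD ?deriveZ//; exact: derivableZ.
have E g : euler g w = w.1 * 'D_(1, 0) g w + w.2 * 'D_(0, 1) g w by [].
rewrite (E (radial_density n G)) (D _ (g1 w) (e1 w)) (D _ (g2 w) (e2 w)).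
rewrite (E (euler G)) (E G).
move: ('D_(1, 0) G w) ('D_(0, 1) G w) ('D_(1, 0) (euler G) w) ('D_(0, 1) (euler G) w).
by move=> p1 p2 p3 p4; ring.
Qed.

Definition power_ray n G (x : R * R) (v : R) : R := v ^+ n * G (v * x.1, v * x.2).

Lemma is_derive_power_ray n G x (v : R) : Ck 1 G ->
  is_derive v 1 (power_ray n.+1 G x) (power_ray n (radial_density n.+1 G) x v).
Proof. exact: is_derive_pow_ray. Qed.

Lemma continuous_power_ray n G x : continuous G -> continuous (power_ray n G x).
Proof.
move=> cG.
have cray : continuous (fun u : R => G (u * x.1, u * x.2)).
  move=> v; apply: (@continuous_comp R (R * R)%type R (fun u => (u * x.1, u * x.2)) G).
    have h1 : u * x.1 @[u --> v] --> v * x.1 by apply: cvgMl; exact: cvg_id.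
    have h2 : u * x.2 @[u --> v] --> v * x.2 by apply: cvgMl; exact: cvg_id.
    exact: (cvg_pair h1 h2).
  exact: cG.
by move=> v; rewrite /power_ray; apply: cvgM; [exact: exprn_continuous|exact: cray].
Qed.

Lemma is_derive_comp_affine (F F' : R -> R) (a b x : R) :
  (forall v : R, is_derive v 1 F (F' v)) ->
  is_derive x 1 (fun y => F (b + a * y)) (a * F' (b + a * x)).
Proof.
move=> dF.
have dA : is_derive x 1 (fun y : R => b + a * y) a.
  have := is_deriveD (is_derive_cst b x 1) (is_deriveZ a (is_derive_id x 1)).
  by rewrite add0r /GRing.scale/= mulr1.
rewrite mulrC; exact: is_derive1_comp (dF _) dA.
Qed.

Lemma integral_power_ray (a : R) G x : 0 < a -> Ck 1 G ->
  (\int[mu]_(y in `[(- a)%R, a]) (power_ray 3 (radial_density 4 G) x (1 - y))%:E =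
   (power_ray 4 G x (1 + a) - power_ray 4 G x (1 - a))%:E)%E.
Proof.
move=> a0 CG.
have dF v := is_derive_power_ray 3 x v CG.
have cH := Ck_continuous (Ck_radial_density 4 CG).
pose q y := - power_ray 4 G x (1 + -1 * y).
have dq (y : R) : is_derive y 1 q (power_ray 3 (radial_density 4 G) x (1 - y)).
  have := is_deriveN (is_derive_comp_affine (-1) 1 y dF).
  by rewrite !mulN1r opprK.
have cq : continuous (fun y : R => power_ray 3 (radial_density 4 G) x (1 - y)).
  move=> y; apply: (@continuous_comp R R R (fun y => 1 - y) (power_ray 3 (radial_density 4 G) x)).
    by apply: cvgB; [exact: cvg_cst|exact: cvg_id].
  exact: continuous_power_ray.
rewrite (integral_derive_continuous _ cq dq); last lra.
by rewrite /q !mulN1r opprK opprK addrC.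
Qed.

(** The segment from 1 to [1 - y] is parametrized by [[0, 1]] whatever [y] is. Bounding by an
    integral rather than a supremum lets the integral over the plane be taken first, where each
    dilation is an exact change of variables. *)
Lemma power_ray_increment G x (y : R) : Ck 1 G ->
  (((power_ray 3 G x (1 - y) - G x) ^+ 2)%:E <=
   \int[mu]_(al in `[0%R, 1%R])
     ((y * power_ray 2 (radial_density 3 G) x (1 - al * y)) ^+ 2)%:E)%E.
Proof.
move=> CG.
have dF v := is_derive_power_ray 2 x v CG.
have cK := Ck_continuous (Ck_radial_density 3 CG).
pose q al := power_ray 3 G x (1 + - y * al).
pose q' al := - y * power_ray 2 (radial_density 3 G) x (1 + - y * al).
have dq (al : R) : is_derive al 1 q (q' al) by exact: is_derive_comp_affine.
have cq' : continuous q'.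
  move=> al; apply: cvgMr.
  have caff : {for al, continuous (fun al : R => 1 + - y * al)}.
    by apply: cvgD; [exact: cvg_cst|apply: cvgMr; exact: cvg_id].
  have cray := @continuous_power_ray 2 _ x cK (1 + - y * al).
  exact: (continuous_comp caff cray).
have := sqr_increment_le_integral cq' dq.
have -> : q 1 - q 0 = power_ray 3 G x (1 - y) - G x.
  rewrite /q mulr1 mulr0 addr0 /power_ray expr1n !mul1r.
  by case: x {dF q q' dq cq'} => x1 x2.
move=> /le_trans; apply.
rewrite le_eqVlt; apply/orP; left; apply/eqP; apply: eq_integral => al _.
by rewrite /q' mulNr sqrrN mulNr (mulrC y al).
Qed.

(** For each [v = 1 - al * y] the squared weight is [v ^+ 4] and the Jacobian contributes [v ^- 2];
    the remaining [v ^+ 2] is at most [9 / 4] because [v <= 3 / 2]. *)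
Lemma power_ray_increment_L2 G (y : R) : `|y| <= 2^-1 -> Ck 1 G ->
  (\int[mu2]_x ((power_ray 3 G x (1 - y) - G x) ^+ 2)%:E <=
   (9 / 4 * y ^+ 2)%:E * \int[mu2]_x ((radial_density 3 G x) ^+ 2)%:E)%E.
Proof.
move=> y12 CG; set K := radial_density 3 G.
have cK := Ck_continuous (Ck_radial_density 3 CG); rewrite -/K in cK.
have mK := continuous_plane_measurable cK.
have mG := continuous_plane_measurable (Ck_continuous CG).
have y2 : - 2^-1 <= y <= 2^-1 by rewrite -ler_norml.
(* The integral over [[0, 1]] is read as one against a probability, to which Tonelli with the plane
   applies. *)
pose U : probability (measurableTypeR R) R := uniform_prob (@ltr01 R).
pose F (z : (measurableTypeR R * measurableTypeR R) * measurableTypeR R) : \bar R :=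
  ((y * power_ray 2 K z.1 (1 - z.2 * y)) ^+ 2)%:E.
have mv : measurable_fun setT
    (fun z : (measurableTypeR R * measurableTypeR R) * measurableTypeR R =>
      1 - z.2 * y : measurableTypeR R).
  by apply: measurable_funB => //; apply: measurable_funM.
have mF : measurable_fun setT F.
  apply/measurable_EFinP; apply: measurable_funX; apply: measurable_funM => //.
  apply: measurable_funM; first exact: measurable_funX.
  apply: (measurableT_comp mK); apply: measurable_fun_pair.
    by apply: measurable_funM => //; apply: measurableT_comp.
  by apply: measurable_funM => //; apply: measurableT_comp.
have F0 z : (0 <= F z)%E by rewrite lee_fin sqr_ge0.
have inner x : (\int[mu]_(al in `[0%R, 1%R]) F (x, al) = \int[U]_al F (x, al))%E.
  rewrite integral_uniform//; first by rewrite subr0 invr1 mul1e.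
  exact: measurableT_comp mF (measurable_pair1 _).
apply: (@le_trans _ _ (\int[mu2]_x \int[U]_al F (x, al))%E).
  apply: ge0_le_integral => //.
  - by move=> x _; rewrite lee_fin sqr_ge0.
  - apply/measurable_EFinP; apply: measurable_funX; apply: measurable_funB => //.
    apply: measurable_funM => //; apply: (measurableT_comp mG).
    by apply: measurable_fun_pair; apply: measurable_funM.
  - exact: (measurable_plane_tonelli1 U mF F0).
  - by move=> x _; rewrite -inner; exact: power_ray_increment.
rewrite (plane_tonelli U mF F0).
have J0 : (0 <= \int[mu2]_x (K x ^+ 2)%:E)%E by apply: integral_ge0 => x _; rewrite lee_fin sqr_ge0.
rewrite integral_uniform//; last 2 first.
- exact: (measurable_plane_tonelli2 mF F0).
- by move=> al; apply: integral_ge0.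
rewrite subr0 invr1 mul1e.
set J := (\int[mu2]_x (K x ^+ 2)%:E)%E in J0 *.
apply: (@le_trans _ _ (\int[mu]_(al in `[0%R, 1%R]) ((9 / 4 * y ^+ 2)%:E * J))%E).
  apply: ge0_le_integral => //.
  - by move=> al _; apply: integral_ge0.
  - apply: measurable_funTS.
    exact: (measurable_plane_tonelli2 mF F0).
  - move=> al; rewrite /= in_itv/= => /andP[al0 al1].
    set v := 1 - al * y.
    have v0 : 0 < v by rewrite /v; nra.
    have v32 : v <= 3 / 2 by rewrite /v; nra.
    rewrite /F/= -/v.
    have -> : (fun x : R * R => ((y * power_ray 2 K x v) ^+ 2)%:E) =
        (fun x => (y ^+ 2 * v ^+ 4)%:E * ((K (v * x.1, v * x.2)) ^+ 2)%:E)%E.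
      by apply/funext => x; rewrite -EFinM; congr EFin; rewrite /power_ray; ring.
    clear inner F0 mF mv; clearbody v.
    rewrite ge0_integralZl; [|exact: measurableT| | |]; last 3 first.
    - apply/measurable_EFinP; apply: measurable_funX; apply: (measurableT_comp mK).
      by apply: measurable_fun_pair; apply: measurable_funM.
    - by move=> x _; rewrite lee_fin sqr_ge0.
    - by rewrite lee_fin mulr_ge0 ?sqr_ge0// exprn_ge0// ltW.
    rewrite (ge0_integral_plane_scale (g := fun w => (K w ^+ 2)%:E)) => [|//||w]; last 2 first.
    - by apply/measurable_EFinP; apply: measurable_funX.
    - by rewrite lee_fin sqr_ge0.
    rewrite muleA -EFinM lee_wpmul2r// lee_fin.
    rewrite (_ : y ^+ 2 * v ^+ 4 / v ^+ 2 = y ^+ 2 * v ^+ 2); last by field; rewrite gt_eqF.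
    rewrite mulrC ler_wpM2r ?sqr_ge0//; nra.
rewrite integral_cst//=; rewrite lebesgue_measure_itv/= lte_fin ltr01 oppr0 adde0 mule1.
exact: lexx.
Qed.

(* The dilations lie in [- a, a] only almost surely; clamping them gives functions of
   the sample that are bounded everywhere. *)
Definition clamp (a y : R) : R := Num.max (- a) (Num.min a y).

Lemma clamp_itv a y : 0 <= a -> - a <= clamp a y <= a.
Proof.
by move=> a0; rewrite /clamp le_max lexx/= ge_max ge_min lexx andbT; lra.
Qed.

Lemma clamp_id a y : - a <= y <= a -> clamp a y = y.
Proof.
by move=> /andP[ay ya]; rewrite /clamp min_r// max_r.
Qed.

Lemma continuous_clamp a : continuous (clamp a).
Proof.
move=> y; apply: (@continuous_max R R (fun=> - a) (fun y => Num.min a y)).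
  exact: cvg_cst.
by apply: (@continuous_min R R (fun=> a) id); [exact: cvg_cst|exact: cvg_id].
Qed.

(** * Mean and variance of the dilated samples *)

Section SampleMean.
Context {d : measure_display} {T : measurableType d}.
Variable P : probability T R.
Variables (a : R) (M : nat) (tau : {RV P >-> R}) (taus : 'I_M -> {RV P >-> R}).
Variables (G : R * R -> R) (aa : - a < a).
Hypotheses (a0 : 0 < a) (a12 : a <= 2^-1) (M0 : (0 < M)%N) (CG : Ck 2 G).
Hypothesis tauU : forall A : set R, measurable A -> distribution P tau A = uniform_prob aa A.
Hypothesis samples : independent_samples tau taus.

Let H := radial_density 4 G.

Definition dilated_sample (x : R * R) (y : R) : R := power_ray 3 H x (1 - clamp a y).

Definition dilation_mean (x : R * R) : R :=
  (2 * a)^-1 * (power_ray 4 G x (1 + a) - power_ray 4 G x (1 - a)).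

Definition sample_deviation (w : T) (x : R * R) : R :=
  dilation_mean x - M%:R^-1 * \sum_(j < M) dilated_sample x (taus j w).

Let CG1 : Ck 1 G. Proof. exact: CkS. Qed.
Let CH : Ck 1 H. Proof. exact: Ck_radial_density. Qed.
Let cH : continuous H. Proof. exact: Ck_continuous CH. Qed.
Let cG : continuous G. Proof. exact: Ck_continuous CG. Qed.

Lemma continuous_dilated_sample x : continuous (dilated_sample x).
Proof.
move=> y; apply: (@continuous_comp R R R (fun y => 1 - clamp a y) (power_ray 3 H x)).
  by apply: cvgB; [exact: cvg_cst|exact: continuous_clamp].
exact: continuous_power_ray.
Qed.

(** The dilation factor lies in [[0, 2]], so all points met are in a box twice the size of the one
    through [x]. The bound depends on [x], which is enough since independence is used at a fixed
    frequency. *)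
Lemma dilated_sample_bounded x : exists B, forall y, `|dilated_sample x y| <= B.
Proof.
have [B B0 HB] := bounded_around_square_box (2 * Num.max `|x.1| `|x.2|)
  (continuous_bounded_around cH).
exists (2 ^+ 3 * B) => y.
have /andP[c1 c2] := clamp_itv y (ltW a0).
rewrite /dilated_sample /power_ray normrM.
have v0 : 0 <= 1 - clamp a y by move: (le_trans c2 a12); lra.
have v2 : 1 - clamp a y <= 2 by move: a12; lra.
move: (1 - clamp a y) v0 v2 => v v0 v2.
rewrite ler_pM//.
  by rewrite normrX ger0_norm// lerXn2r// nnegrE.
apply: HB.
have [/=] := mem_square_box x; rewrite !in_itv/= => /andP[x1 x1'] /andP[x2 x2'].
by split; rewrite /= in_itv/=; apply/andP; split; nra.
Qed.

Lemma integral_dilated_sample (X : {RV P >-> R}) x :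
  (forall A : set R, measurable A -> distribution P X A = uniform_prob aa A) ->
  (\int[P]_w (dilated_sample x (X w))%:E = (dilation_mean x)%:E)%E.
Proof.
move=> XU; rewrite (integral_uniform_sample XU (@continuous_dilated_sample x)).
rewrite (_ : a - - a = 2 * a); last by ring.
have -> : (\int[mu]_(y in `[(- a)%R, a]) (dilated_sample x y)%:E =
    (power_ray 4 G x (1 + a) - power_ray 4 G x (1 - a))%:E)%E.
  rewrite -(integral_power_ray x a0 CG1); apply: eq_integral => y.
  by rewrite inE/= in_itv/= => ya; rewrite /dilated_sample clamp_id.
by rewrite -EFinM.
Qed.

Let measurable_dilated_sample (X : {RV P >-> R}) : measurable_fun setT
  (fun z : (measurableTypeR R * measurableTypeR R) * T => dilated_sample z.1 (X z.2)).
Proof.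
have mH := continuous_plane_measurable cH.
have mv : measurable_fun setT
    (fun z : (measurableTypeR R * measurableTypeR R) * T =>
      1 - clamp a (X z.2) : measurableTypeR R).
  apply: measurable_funB => //.
  apply: (measurableT_comp (continuous_measurable_fun (@continuous_clamp a))).
  exact: measurableT_comp.
apply: measurable_funM; first exact: measurable_funX.
apply: (measurableT_comp mH); apply: measurable_fun_pair.
  by apply: measurable_funM => //; apply: measurableT_comp.
by apply: measurable_funM => //; apply: measurableT_comp.
Qed.

Let measurable_sample_deviation : measurable_fun setT
  (fun z : (measurableTypeR R * measurableTypeR R) * T => sample_deviation z.2 z.1).
Proof.
apply: measurable_funB; last first.
  by apply: measurable_funM => //; apply: measurable_sum => j; exact: measurable_dilated_sample.
apply: (@measurableT_comp _ _ _ _ _ _ dilation_mean _ fst) => //.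
have mG := continuous_plane_measurable cG.
apply: measurable_funM => //; apply: measurable_funB; apply: measurable_funM => //;
  apply: (measurableT_comp mG); apply: measurable_fun_pair; exact: measurable_funM.
Qed.

Lemma measurable_sample_deviation_L2 :
  measurable_fun setT (fun w => \int[mu2]_x ((sample_deviation w x) ^+ 2)%:E)%E.
Proof.
apply: (@measurable_plane_tonelli2 _ _ (fun z => ((sample_deviation z.2 z.1) ^+ 2)%:E)).
  by apply/measurable_EFinP; exact: measurable_funX.
by move=> z; rewrite lee_fin sqr_ge0.
Qed.

(** The center chosen is [H x], the value of an undilated sample, rather than the expectation: the
    remaining quantity is then an increment along the ray through [x]. *)
Lemma pointwise_sample_deviation x :
  (\int[P]_w ((sample_deviation w x) ^+ 2)%:E <=
   (M%:R^-1)%:E * \int[P]_w ((dilated_sample x (tau w) - H x) ^+ 2)%:E)%E.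
Proof.
have [B xB] := dilated_sample_bounded x.
have cS := @continuous_dilated_sample x.
pose phi y := (dilated_sample x y - H x) ^+ 2.
have cphi : continuous phi.
  have cd : continuous (fun y : R => dilated_sample x y - H x).
    by move=> y; apply: cvgB; [exact: cS|exact: cvg_cst].
  by move=> y; exact: (continuous_comp (cd y) (@exprn_continuous _ 2 _)).
have tausU j (A : set R) : measurable A -> distribution P (taus j) A = uniform_prob aa A.
  by move=> mA; rewrite samples.2// tauU.
have mS : measurable_fun [set: R] (dilated_sample x) by exact: continuous_measurable_fun.
have fin : (\int[P]_w (phi (tau w))%:E)%E \is a fin_num.
  apply: integral_fune_fin_num => //.
  apply: (@integrable_bounded_sample _ _ _ P (phi \o tau) ((B + `|H x|) ^+ 2)).
    apply: measurableT_comp => //; exact: continuous_measurable_fun.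
  move=> w; rewrite /phi/= normrX lerXn2r// ?nnegrE// ?addr_ge0//.
    by apply: le_trans (xB 0).
  by apply: le_trans (ler_normB _ _) _; rewrite lerD2r.
rewrite -(fineK fin) -EFinM mulrC.
apply: (@sample_mean_variance _ _ _ P M taus (dilated_sample x) B (dilation_mean x) (H x)) => //.
- exact: samples.1.
- by move=> j; exact: (integral_dilated_sample x (@tausU j)).
- move=> j; rewrite (fineK fin).
  by rewrite (integral_uniform_sample (@tausU j) cphi) (integral_uniform_sample tauU cphi).
Qed.

(** Tonelli exchanges frequency and chance twice, around the pointwise variance bound. The factor
    [3 / 4 * a ^+ 2] is [9 / 4] times the second moment [a ^+ 2 / 3] of the dilation. *)
Lemma sample_deviation_L2 :
  (\int[P]_w \int[mu2]_x ((sample_deviation w x) ^+ 2)%:E <=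
   (3 / 4 * a ^+ 2 / M%:R)%:E * \int[mu2]_x ((radial_density 3 H x) ^+ 2)%:E)%E.
Proof.
have J0 : (0 <= \int[mu2]_x ((radial_density 3 H x) ^+ 2)%:E)%E.
  by apply: integral_ge0 => x _; rewrite lee_fin sqr_ge0.
set J := (\int[mu2]_x ((radial_density 3 H x) ^+ 2)%:E)%E in J0 *.
pose FV (z : (measurableTypeR R * measurableTypeR R) * T) := ((sample_deviation z.2 z.1) ^+ 2)%:E.
pose FS (z : (measurableTypeR R * measurableTypeR R) * T) :=
  ((dilated_sample z.1 (tau z.2) - H z.1) ^+ 2)%:E.
have mFV : measurable_fun setT FV by apply/measurable_EFinP; exact: measurable_funX.
have mFS : measurable_fun setT FS.
  apply/measurable_EFinP; apply: measurable_funX; apply: measurable_funB => //.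
  by apply: (measurableT_comp (continuous_plane_measurable cH)).
have FV0 z : (0 <= FV z)%E by rewrite lee_fin sqr_ge0.
have FS0 z : (0 <= FS z)%E by rewrite lee_fin sqr_ge0.
rewrite -(plane_tonelli P mFV FV0).
have Mi0 : 0 <= M%:R^-1 :> R by rewrite invr_ge0.
apply: (@le_trans _ _ (\int[mu2]_x ((M%:R^-1)%:E * \int[P]_w FS (x, w)))%E).
  apply: ge0_le_integral => //.
  - by move=> x _; apply: integral_ge0.
  - exact: (measurable_plane_tonelli1 P mFV FV0).
  - by apply: measurable_funeM; exact: (measurable_plane_tonelli1 P mFS FS0).
  - by move=> x _; exact: pointwise_sample_deviation.
rewrite ge0_integralZl; [|exact: measurableT|exact: (measurable_plane_tonelli1 P mFS FS0)
  |by move=> x _; apply: integral_ge0|by rewrite lee_fin].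
rewrite (plane_tonelli P mFS FS0).
have mc : measurable_fun setT (fun w => ((9 / 4 * clamp a (tau w) ^+ 2)%:E)).
  apply/measurable_EFinP; apply: measurable_funM => //; apply: measurable_funX.
  apply: (measurableT_comp (continuous_measurable_fun (@continuous_clamp a))).
  exact: measurable_funP.
have c0 w : (0 <= (9 / 4 * clamp a (tau w) ^+ 2)%:E)%E by rewrite lee_fin mulr_ge0 ?sqr_ge0.
apply: (@le_trans _ _ ((M%:R^-1)%:E * \int[P]_w ((9 / 4 * clamp a (tau w) ^+ 2)%:E * J))%E).
  apply: lee_wpmul2l; first by rewrite lee_fin.
  apply: ge0_le_integral => //.
  - by move=> w _; apply: integral_ge0.
  - exact: (measurable_plane_tonelli2 mFS FS0).
  - by apply: emeasurable_funM.
  - move=> w _.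
    have ct : `|clamp a (tau w)| <= 2^-1.
      have := clamp_itv (tau w) (ltW a0); rewrite -ler_norml => /le_trans; exact.
    exact: (power_ray_increment_L2 ct CH).
rewrite ge0_integralZr//.
have csq : continuous (fun y : R => 9 / 4 * clamp a y ^+ 2).
  move=> y; apply: cvgMr.
  exact: (continuous_comp (@continuous_clamp a y) (@exprn_continuous _ 2 _)).
rewrite (integral_uniform_sample tauU csq).
have -> : (\int[mu]_(x in `[(- a)%R, a]) (9 / 4 * clamp a x ^+ 2)%:E =
    (9 / 4 * (2 * a ^+ 3 / 3))%:E)%E.
  transitivity (\int[mu]_(x in `[(- a)%R, a]) ((9 / 4)%:E * (x ^+ 2)%:E))%E.
    apply: eq_integral => y; rewrite inE/= in_itv/= => ya.
    by rewrite clamp_id// EFinM.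
  have csq2 : continuous (fun x : R => x ^+ 2) by exact: exprn_continuous.
  rewrite integralZl//; last first.
    apply: continuous_compact_integrable; first exact: segment_compact.
    exact: continuous_subspaceT.
  rewrite (integral_derive_continuous aa csq2 (is_derive_primitive_expn 2)).
  by rewrite -EFinM; congr EFin; field.
rewrite -EFinM !muleA -EFinM lee_wpmul2r// lee_fin le_eqVlt; apply/orP; left; apply/eqP.
rewrite (_ : a - - a = 2 * a); last by ring.
by field; rewrite !gt_eqF ?ltr0n.
Qed.

End SampleMean.

End RealCore.

(** * The estimator *)

Section Resolvent.
Context {R : realType}.
Local Notation mu2 := (@lebesgue_measure R \x @lebesgue_measure R)%E.

Lemma resolvent_deviation_L2 (a : R) (u V : R * R -> R) : 0 < a <= 2^-1 ->
  continuous V -> bounded_around u ->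
  (forall w, u w - real_dilation ((1 - a) / (1 + a)) u w =
     2 * a * real_dilation (1 + a)^-1 V w) ->
  (\int[mu2]_w ((u w) ^+ 2)%:E <= \int[mu2]_w ((V w) ^+ 2)%:E)%E.
Proof.
move=> /andP[a0 a12] cV bu uV.
have a1 : 0 < 1 + a by lra.
set c2 := (1 + a)^-1 in uV; set c := (1 - a) / (1 + a) in uV.
have c2E : c2 * (1 + a) = 1 by rewrite mulVf// gt_eqF.
have cE : c = (1 - a) * c2 by [].
have c20 : 0 < c2 by rewrite invr_gt0.
have c21 : c2 <= 1 by rewrite invf_le1// lerDl ltW.
have cc : 0 < c < 1 by rewrite cE; apply/andP; split; nra.
have cD : continuous (fun w => 2 * a * real_dilation c2 V w).
  move=> w; apply: cvgMr; apply: cvgMr.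
  exact: (@continuous_plane_scale _ V c2 cV w).
apply: le_trans (resolvent_dilation_energy cc cD bu uV) _.
have mV : measurable_fun [set: measurableTypeR R * measurableTypeR R]
    (fun w => ((V w) ^+ 2)%:E).
  by apply/measurable_EFinP/measurable_funX; exact: continuous_plane_measurable.
have V0 w : (0 <= ((V w) ^+ 2)%:E :> \bar R)%E by rewrite lee_fin sqr_ge0.
have -> : (\int[mu2]_w ((2 * a * real_dilation c2 V w) ^+ 2)%:E =
    ((2 * a * c2 ^+ 3) ^+ 2)%:E * \int[mu2]_w ((V w) ^+ 2)%:E)%E.
  transitivity (\int[mu2]_w (((2 * a * c2 ^+ 4) ^+ 2)%:E *
      ((V (c2 * w.1, c2 * w.2)) ^+ 2)%:E))%E.
    by apply: eq_integral => w _; rewrite -EFinM; congr EFin; rewrite /real_dilation; ring.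
  rewrite ge0_integralZl; [|exact: measurableT| | |by rewrite lee_fin sqr_ge0]; last 2 first.
  - apply: (measurableT_comp mV).
    by apply: measurable_fun_pair; apply: measurable_funM.
  - by move=> w _; exact: V0.
  rewrite (ge0_integral_plane_scale c20 mV V0) muleA -EFinM; congr (_%:E * _)%E.
  by field; rewrite gt_eqF.
rewrite muleA -EFinM -[leRHS]mul1e; apply: lee_wpmul2r.
  by apply: integral_ge0 => w _; exact: V0.
rewrite lee_fin -exprVn -exprMn -[leRHS](expr1n _ 2).
have c3 : c ^+ 3 <= c.
  have /andP[/ltW c0 /ltW c1] := cc.
  by rewrite exprS ler_piMr// exprn_ile1.
have c3p : 0 < 1 - c ^+ 3 by move/andP: cc => [_]; lra.
have c23 : 0 <= c2 ^+ 3 <= c2.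
  rewrite exprn_ge0 ?(ltW c20)//= exprS ler_piMr ?(ltW c20)// exprn_ile1 ?(ltW c20)//.
(* Chain: [2 * a * c2 ^+ 3 <= 2 * a * c2 = 1 - c <= 1 - c ^+ 3]. *)
have key : 2 * a * c2 ^+ 3 <= 1 - c ^+ 3.
  move/andP: c23 => [_ c23]; nra.
rewrite lerXn2r ?nnegrE ?ler01//.
  apply: mulr_ge0; first by rewrite invr_ge0 ltW.
  by apply: mulr_ge0; [rewrite mulr_ge0 ?ltW|case/andP: c23].
by rewrite mulrC ler_pdivrMr// mul1r.
Qed.

Lemma L2norm_sqr (g : R * R -> R[i]) :
  (L2norm g ^+ 2 =
   \int[mu2]_w ((complex.Re (g w)) ^+ 2 + (complex.Im (g w)) ^+ 2)%:E)%E.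
Proof.
transitivity (L2norm g `^ 2)%E.
  have := Lnorm_ge0 mu2 2%:E (fun w => (Normc.normc (g w))%:E).
  rewrite -/(L2norm g); case: (L2norm g) => [r r0| _|//].
    by rewrite poweR_EFin powR_mulrn.
  by rewrite poweRyr.
rewrite /L2norm poweR_Lnorm//; apply: eq_integral => w _.
rewrite abse_EFin poweR_EFin powR_mulrn//.
case: (g w) => x y /=.
by rewrite real_normK ?num_real// sqr_sqrtr// addr_ge0// sqr_ge0.
Qed.

(** Measurability is asked of the majorant only, since the squared error norm is not shown to be
    measurable in the outcome. The integral of a nonnegative function is a supremum over simple
    functions below it, hence monotone in any case; raising [g] to infinity on a null set makes the
    comparison hold everywhere. *)
Lemma ge0_le_integral_majorant d (T : measurableType d)
    (m : {measure set T -> \bar R}) (f g : T -> \bar R) :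
  (forall x, 0 <= f x)%E -> (forall x, 0 <= g x)%E -> measurable_fun setT g ->
  {ae m, forall x, (f x <= g x)%E} -> (\int[m]_x f x <= \int[m]_x g x)%E.
Proof.
move=> f0 g0 mg [N [mN mN0 fgN]].
pose g' x := (if x \in N then +oo else g x)%E.
have mg' : measurable_fun setT g'.
  apply: measurable_fun_if => //; last exact: measurable_funTS.
  apply: (measurable_fun_bool true); rewrite setTI.
  by rewrite (_ : _ @^-1` _ = N)//; apply/seteqP; split=> x /=; [move/set_mem|move/mem_set].
have fg' x : (f x <= g' x)%E.
  rewrite /g'; case: ifPn => [_|/negP xN]; first exact: leey.
  by apply: contrapT => nfg; apply: xN; apply/mem_set/fgN.
have g'0 x : (0 <= g' x)%E by exact: le_trans (fg' x).
apply: (@le_trans _ _ (\int[m]_x g' x)%E).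
  rewrite !ge0_integralTE//; apply: ereal_sup_le => _ [h hf <-].
  exists h => // x.
  exact: le_trans (hf x) (fg' x).
apply: ae_ge0_le_integral => //.
exists N; split => // x /= nE; apply: contrapT => xN; apply: nE => _.
by rewrite /g' memNset.
Qed.

(** Extracts one outcome, from which a property of the deterministic signal can be read off. *)
Lemma ae_nonempty d (T : measurableType d) (P : probability T R) (Q : T -> Prop) :
  {ae P, forall w, Q w} -> exists w, Q w.
Proof.
move=> [N [mN PN QN]]; apply: contrapT => noQ.
have : P setT = 0%E.
  apply/eqP; rewrite eq_le measure_ge0 andbT -PN le_measure ?inE//.
  by move=> w _; apply: QN => Qw; apply: noQ; exists w.
by rewrite probability_setT => -[] /eqP; rewrite oner_eq0.
Qed.

End Resolvent.

(** * The estimator, coordinate by coordinate *)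

Section Estimator.
Context {R : realType}.
Local Notation mu := (@lebesgue_measure R).
Local Notation mu2 := (@lebesgue_measure R \x @lebesgue_measure R)%E.
Local Open Scope complex_scope.

Lemma Re_r_radial_derive k (g : R * R -> R[i]) w :
  complex.Re (r_radial_derive k g w) = Defs.radius w ^+ k *
    derive1n k (fun s => complex.Re (g (s * cos (angle w), s * sin (angle w)))) (Defs.radius w).
Proof. by rewrite /r_radial_derive /of_polar /radial_derive/=; simpc. Qed.

Lemma Im_r_radial_derive k (g : R * R -> R[i]) w :
  complex.Im (r_radial_derive k g w) = Defs.radius w ^+ k *
    derive1n k (fun s => complex.Im (g (s * cos (angle w), s * sin (angle w)))) (Defs.radius w).
Proof. by rewrite /r_radial_derive /of_polar /radial_derive/=; simpc. Qed.

(** The Euler operator commutes with dilations and with finite sums. *)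
Lemma radius_derive1_mean (M : nat) (s : 'I_M -> R) (G : R * R -> R) w : Ck 1 G ->
  Defs.radius w ^+ 1 * derive1n 1 (fun u => M%:R^-1 * \sum_(j < M) s j ^+ 3 *
    G (s j * (u * cos (angle w)), s j * (u * sin (angle w)))) (Defs.radius w) =
  M%:R^-1 * \sum_(j < M) s j ^+ 3 * euler G (s j * w.1, s j * w.2).
Proof.
move=> CG; set r := Defs.radius w; set a := cos _; set b := sin _.
have /= w1 := congr1 fst (polarK w); have /= w2 := congr1 snd (polarK w).
rewrite -/r -/a in w1; rewrite -/r -/b in w2.
have D j := is_derive_ray (s j * a) (s j * b) r CG.
have DS : is_derive r 1 (fun u => M%:R^-1 * \sum_(j < M) s j ^+ 3 *
      G (s j * (u * a), s j * (u * b)))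
    (M%:R^-1 * \sum_(j < M) s j ^+ 3 *
      (s j * a * 'D_(1, 0) G (r * (s j * a), r * (s j * b)) +
       s j * b * 'D_(0, 1) G (r * (s j * a), r * (s j * b)))).
  have -> : (fun u => M%:R^-1 * \sum_(j < M) s j ^+ 3 *
      G (s j * (u * a), s j * (u * b))) =
    M%:R^-1 \*: \sum_(j < M) (s j ^+ 3 \*: (fun u : R => G (u * (s j * a), u * (s j * b)))).
    apply/funext => u /=; congr (_ * _); rewrite fct_sumE; apply: eq_bigr => j _.
    by congr (_ * G (_, _)); rewrite mulrCA.
  by apply: is_deriveZ; apply: is_derive_sum => j; apply: is_deriveZ.
rewrite expr1 /derive1n/= derive1E; case: DS => _ ->.
rewrite mulrCA mulr_sumr; congr (_ * _); apply: eq_bigr => j _.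
rewrite /euler/= -w1 -w2 [r * (s j * a)]mulrCA [r * (s j * b)]mulrCA.
move: ('D_(1, 0) G _) ('D_(0, 1) G _) => p q; ring.
Qed.

(** Treats real and imaginary parts in one proof through what they share: real linearity and
    domination by the modulus. *)
Definition coordinate (p : R[i] -> R) : Prop := p = @complex.Re R \/ p = @complex.Im R.

Lemma coordinateD p x y : coordinate p -> p (x + y) = p x + p y.
Proof. by case=> ->; case: x y => ? ? [? ?]. Qed.

Lemma coordinateZ p (r : R) z : coordinate p -> p (r%:C * z) = r * p z.
Proof. by case=> ->; case: z => x y /=; rewrite mul0r ?subr0 ?addr0. Qed.

Lemma coordinateB p x y : coordinate p -> p (x - y) = p x - p y.
Proof. by case=> ->; case: x y => ? ? [? ?]. Qed.

Lemma coordinate_sum p (M : nat) (F : 'I_M -> R[i]) : coordinate p ->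
  p (\sum_(j < M) F j) = \sum_(j < M) p (F j).
Proof.
move=> cp; apply: (big_morph p (fun x y => coordinateD x y cp)).
by case: cp => ->.
Qed.

Lemma coordinate_le p z : coordinate p -> `|p z| <= Normc.normc z.
Proof.
by case=> ->; case: z => x y /=; rewrite -sqrtr_sqr ler_wsqrtr// ?lerDl ?lerDr sqr_ge0.
Qed.

Lemma coordinate_radial p k (g : R * R -> R[i]) w : coordinate p ->
  p (r_radial_derive k g w) = Defs.radius w ^+ k *
    derive1n k (fun s => p (g (s * cos (angle w), s * sin (angle w)))) (Defs.radius w).
Proof. by case=> ->; rewrite ?Re_r_radial_derive ?Im_r_radial_derive. Qed.

Lemma coordinate_dilation p c (g : R * R -> R[i]) w : coordinate p ->
  p (dilation c g w) = real_dilation c (fun x => p (g x)) w.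
Proof. by move=> cp; rewrite /dilation coordinateZ. Qed.

Lemma continuous_deviation_mean (M : nat) (s : 'I_M -> R) n (H : R * R -> R) : continuous H ->
  continuous (fun x => M%:R^-1 * \sum_(j < M) power_ray n H x (s j)).
Proof.
move=> cH.
have csum (r : seq 'I_M) : continuous (fun x => \sum_(j <- r) power_ray n H x (s j)).
  elim: r => [|j r IH].
    have -> : (fun x : R * R => \sum_(j <- [::]) power_ray n H x (s j)) = (fun=> 0).
      by apply/funext => x; rewrite big_nil.
    by move=> x; exact: cvg_cst.
  have -> : (fun x => \sum_(k <- j :: r) power_ray n H x (s k)) =
      (fun x => power_ray n H x (s j) + \sum_(k <- r) power_ray n H x (s k)).
    by apply/funext => x; rewrite big_cons.
  move=> x; apply: cvgD; last exact: IH.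
  by apply: cvgMr; exact: (@continuous_plane_scale _ H (s j) cH x).
by move=> x; apply: cvgMr; exact: csum.
Qed.

(** * The estimator at one fixed outcome of the sample *)

Section Observations.
Variables (f : R -> R) (eta : R) (M : nat) (t tau : 'I_M -> R).
Let a := Num.sqrt 3 * eta.
Hypotheses (eta0 : 0 < eta) (a12 : a <= 2^-1).
Hypothesis B3 : complex_Ck 3 (bispectrum f).
Hypothesis fi : mu.-integrable setT (EFin \o f).
Hypothesis tau_itv : forall j, - a <= tau j <= a.

Let fs (j : 'I_M) := observation f (t j) (tau j).

Let a0 : 0 < a. Proof. by rewrite mulr_gt0// sqrtr_gt0. Qed.

Let s0 j : 0 < 1 - tau j.
Proof. by have /andP[_ ta] := tau_itv j; move: (le_trans ta a12); lra. Qed.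

Lemma Ck_coordinate p : coordinate p -> Ck 3 (fun w => p (bispectrum f w)).
Proof. by case: B3 => C1 C2; case=> ->. Qed.

Lemma coordinate_mean_bispectrum p w : coordinate p ->
  p (mean_bispectrum fs w) = M%:R^-1 * \sum_(j < M) (1 - tau j) ^+ 3 *
    p (bispectrum f ((1 - tau j) * w.1, (1 - tau j) * w.2)).
Proof.
move=> cp; rewrite /mean_bispectrum.
have -> : (M%:R^-1 : R[i]) = (M%:R^-1)%:C by rewrite fmorphV rmorph_nat.
rewrite coordinateZ// coordinate_sum//; congr (_ * _); apply: eq_bigr => j _.
by rewrite bispectrum_observation// coordinateZ.
Qed.

(** The coordinate [p] of [4 g + E g], where [g] is the mean bispectrum of the observations. *)
Definition recentered_mean p x := M%:R^-1 * \sum_(j < M)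
  power_ray 3 (radial_density 4 (fun w => p (bispectrum f w))) x (1 - tau j).

Lemma coordinate_estimator_input p w : coordinate p ->
  p ((C1 eta)%:C * dilation (C2 eta) (fun w' => 4 * mean_bispectrum fs w' +
      r_radial_derive 1 (mean_bispectrum fs) w') w) =
  2 * a * real_dilation (1 + a)^-1 (recentered_mean p) w.
Proof.
move=> cp; rewrite coordinateZ// coordinate_dilation//.
have -> : C1 eta = 2 * a by rewrite /C1 /a mulrA.
congr (_ * (_ * _)); set x := (_, _).
have -> : (4 : R[i]) = (4 : R)%:C by rewrite rmorph_nat.
rewrite coordinateD// coordinateZ// coordinate_radial//.
under eq_fun do rewrite coordinate_mean_bispectrum//.
have CG := CkS (CkS (Ck_coordinate cp)).
rewrite (radius_derive1_mean (fun j => 1 - tau j) x CG) coordinate_mean_bispectrum//.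
rewrite /recentered_mean mulrCA -mulrDr; congr (_ * _).
rewrite mulr_sumr -big_split/=; apply: eq_bigr => j _.
by rewrite /power_ray /radial_density [RHS]mulrDr; congr (_ + _); rewrite mulrCA.
Qed.

Lemma C0E : C0 eta = (1 - a) / (1 + a). Proof. by []. Qed.

Lemma C0_itv : 0 < C0 eta < 1.
Proof.
rewrite C0E; have a1 : 0 < 1 + a by move: a0; lra.
rewrite divr_gt0//; last by move: a12; lra.
by rewrite ltr_pdivrMr//; move: a0; lra.
Qed.

(** [inv_sub_dilation] is a choice with default value 0, so it means something only once a solution
    exists; one is assembled from two real Neumann series. Afterwards the estimator is known only
    through its equation and its local boundedness. *)
Lemma bispectrum_estimatorP p : coordinate p ->
  bounded_around (fun w => p (bispectrum_estimator eta fs w)) /\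
  forall w, p (bispectrum_estimator eta fs w) -
    real_dilation (C0 eta) (fun x => p (bispectrum_estimator eta fs x)) w =
    2 * a * real_dilation (1 + a)^-1 (recentered_mean p) w.
Proof.
move=> cp.
have cont q : coordinate q ->
    continuous (fun w => 2 * a * real_dilation (1 + a)^-1 (recentered_mean q) w).
  move=> cq w; apply: cvgMr; apply: cvgMr.
  have cH := Ck_continuous (Ck_radial_density 4 (Ck_coordinate cq)).
  have cS := @continuous_deviation_mean M (fun j => 1 - tau j) 3 _ cH.
  exact: (@continuous_plane_scale _ (recentered_mean q) _ cS w).
have cRe : coordinate (@complex.Re R) by left.
have cIm : coordinate (@complex.Im R) by right.
have [u [bu uE]] := resolvent_dilation_exists C0_itv (cont _ cRe).
have [v [bv vE]] := resolvent_dilation_exists C0_itv (cont _ cIm).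
set hC := fun w => (C1 eta)%:C * dilation (C2 eta) (fun w' => 4 * mean_bispectrum fs w' +
      r_radial_derive 1 (mean_bispectrum fs) w') w.
have : [set z | locally_bounded z /\ forall w, z w - dilation (C0 eta) z w = hC w]
    (bispectrum_estimator eta fs).
  rewrite /bispectrum_estimator /inv_sub_dilation -/hC; apply: xgetPex.
  exists (fun w => u w +i* v w); split.
    move=> w0; have [A HA] := bu w0; have [A' HA'] := bv w0.
    exists (A + A'); near=> w.
    apply: (@le_trans _ _ (`|u w| + `|v w|)).
      rewrite /= -[leRHS]ger0_norm ?addr_ge0// -sqrtr_sqr ler_wsqrtr//.
      rewrite sqrrD !real_normK ?num_real// -addrA lerD2l lerDr.
      by rewrite mulrn_wge0// mulr_ge0.
    by apply: lerD; near: w.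
  move=> w; apply/eqP; rewrite eq_complex; apply/andP; split; apply/eqP.
    by rewrite (coordinateB _ _ cRe) (coordinate_dilation _ _ _ cRe)
      (coordinate_estimator_input w cRe) -uE.
  by rewrite (coordinateB _ _ cIm) (coordinate_dilation _ _ _ cIm)
    (coordinate_estimator_input w cIm) -vE.
move=> [lb eqn]; split.
  move=> w0; have [A HA] := lb w0; exists A; apply: filterS HA => w.
  by apply: le_trans; exact: coordinate_le.
move=> w; rewrite -coordinate_dilation// -coordinateB// eqn.
exact: coordinate_estimator_input.
Unshelve. all: by end_near. Qed.

(** [G] itself solves the resolvent equation with [dilation_mean] as input, so the difference solves
    it with the deviation as input. Measurability in the frequency is recorded because the squared
    norm will be split into its two coordinate integrals. *)
Lemma coordinate_estimator_error p : coordinate p ->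
  let G := fun w => p (bispectrum f w) in
  let u := fun w => p (bispectrum f w - bispectrum_estimator eta fs w) in
  measurable_fun [set: measurableTypeR R * measurableTypeR R] u /\
  (\int[mu2]_w ((u w) ^+ 2)%:E <= \int[mu2]_w
    ((dilation_mean a G w -
      M%:R^-1 * \sum_(j < M) dilated_sample a G w (tau j)) ^+ 2)%:E)%E.
Proof.
move=> cp G u; have [be eqe] := bispectrum_estimatorP cp.
have CG : Ck 3 G := Ck_coordinate cp.
have cG := Ck_continuous CG.
have cH := Ck_continuous (Ck_radial_density 4 CG).
have uE w : u w = G w - p (bispectrum_estimator eta fs w) by rewrite /u coordinateB.
have bu : bounded_around u.
  move=> w0; have [A HA] := be w0; have [A' HA'] := continuous_bounded_around cG w0.
  exists (A' + A); near=> w; rewrite uE; apply: le_trans (ler_normB _ _) _.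
  by apply: lerD; near: w.
pose V w := dilation_mean a G w -
      M%:R^-1 * \sum_(j < M) dilated_sample a G w (tau j).
have VE w : V w = dilation_mean a G w - recentered_mean p w.
  have sE j : dilated_sample a G w (tau j) = power_ray 3 (radial_density 4 G) w (1 - tau j).
    by rewrite /dilated_sample clamp_id.
  by rewrite /V (eq_bigr _ (fun j _ => sE j)).
have cm : continuous (dilation_mean a G).
  move=> w; apply: cvgMr; apply: cvgB; apply: cvgMr.
    exact: (@continuous_plane_scale _ G (1 + a) cG w).
  exact: (@continuous_plane_scale _ G (1 - a) cG w).
have cV : continuous V.
  move=> w; apply: cvgB; first exact: cm.
  have -> : (fun w => M%:R^-1 * \sum_(j < M) dilated_sample a G w (tau j)) =
      (fun x => M%:R^-1 * \sum_(j < M) power_ray 3 (radial_density 4 G) x (1 - clamp a (tau j))).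
    by [].
  exact: (@continuous_deviation_mean M (fun j => 1 - clamp a (tau j)) 3 _ cH w).
have a1 : 0 < 1 + a by move: a0; lra.
have eqn w : u w - real_dilation ((1 - a) / (1 + a)) u w = 2 * a * real_dilation (1 + a)^-1 V w.
  rewrite /real_dilation uE uE VE.
  have := eqe w; rewrite /real_dilation C0E.
  set e1 := p _; set e2 := p _; move=> E.
  have -> : G w - e1 - ((1 - a) / (1 + a)) ^+ 4 *
      (G ((1 - a) / (1 + a) * w.1, (1 - a) / (1 + a) * w.2) - e2) =
    G w - ((1 - a) / (1 + a)) ^+ 4 * G ((1 - a) / (1 + a) * w.1, (1 - a) / (1 + a) * w.2) -
    (e1 - ((1 - a) / (1 + a)) ^+ 4 * e2) by ring.
  rewrite E !mulrBr; congr (_ - _).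
  rewrite /dilation_mean /power_ray/=.
  (* Rescaling by [(1 + a)^-1] turns the end factors [1 + a] and [1 - a] into 1 and [C0]. *)
  have e (x : R) : (1 + a) * ((1 + a)^-1 * x) = x by rewrite mulrA divff ?mul1r// gt_eqF.
  have e' (x : R) : (1 - a) * ((1 + a)^-1 * x) = (1 - a) / (1 + a) * x by rewrite mulrA.
  rewrite !e !e' -[(w.1, w.2)]surjective_pairing.
  by field; rewrite !gt_eqF.
split.
  apply: (measurable_resolvent C0_itv _ bu eqn).
  move=> w; apply: cvgMr; apply: cvgMr.
  exact: (@continuous_plane_scale _ V _ cV w).
by apply: (resolvent_deviation_L2 _ cV bu eqn); rewrite a0.
Unshelve. all: by end_near. Qed.

End Observations.

End Estimator.

(** * From the variance density to the three norms of the statement *)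

Section Bounds.
Context {R : realType}.
Local Notation mu2 := (@lebesgue_measure R \x @lebesgue_measure R)%E.

(** The left side is the square of [12 B + 8 r B_r + r^2 B_rr] for [B = G]. A sum of three terms has
    square at most three times the sum of squares, and 432 is [3 * 12 ^+ 2], the largest
    coefficient. *)
Lemma radial_density_sqr_le (G : R * R -> R) w : Ck 2 G ->
  radial_density 3 (radial_density 4 G) w ^+ 2 <=
  432 * (G w ^+ 2 + euler G w ^+ 2 + (euler (euler G) w - euler G w) ^+ 2).
Proof.
move=> CG.
have -> : radial_density 3 (radial_density 4 G) w =
    12 * G w + 8 * euler G w + (euler (euler G) w - euler G w).
  by rewrite /radial_density -/(radial_density 4 G) euler_radial_density//; ring.
move: (G w) (euler G w) (euler (euler G) w - euler G w) => x y z.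
have := sqr_ge0 (12 * x - 8 * y); have := sqr_ge0 (12 * x - z); have := sqr_ge0 (8 * y - z).
have := sqr_ge0 y; have := sqr_ge0 z; nra.
Qed.

Lemma L2norm_sqr_ge0 (g : R * R -> R[i]) : (0 <= L2norm g ^+ 2)%E.
Proof.
rewrite L2norm_sqr; apply: integral_ge0 => w _.
by rewrite lee_fin addr_ge0 ?sqr_ge0.
Qed.

Lemma coordinate_radial1 (g : R * R -> R[i]) p w : coordinate p ->
  Ck 1 (fun x => p (g x)) -> p (r_radial_derive 1 g w) = euler (fun x => p (g x)) w.
Proof. by move=> cp Cg; rewrite coordinate_radial//; exact: (radius_derive1 w Cg). Qed.

Lemma coordinate_radial2 (g : R * R -> R[i]) p w : coordinate p ->
  Ck 2 (fun x => p (g x)) -> p (r_radial_derive 2 g w) =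
    euler (euler (fun x => p (g x))) w - euler (fun x => p (g x)) w.
Proof. by move=> cp Cg; rewrite coordinate_radial//; exact: (radius_derive2 w Cg). Qed.

Lemma radial_density_L2_le (g : R * R -> R[i]) : complex_Ck 3 g ->
  ((\int[mu2]_w
      ((radial_density 3 (radial_density 4 (fun x => complex.Re (g x))) w) ^+ 2)%:E) +
   (\int[mu2]_w
      ((radial_density 3 (radial_density 4 (fun x => complex.Im (g x))) w) ^+ 2)%:E) <=
   432%:E * (L2norm g ^+ 2 + L2norm (r_radial_derive 1 g) ^+ 2 +
             L2norm (r_radial_derive 2 g) ^+ 2))%E.
Proof.
move=> [C1 C2].
pose K p w : R := radial_density 3 (radial_density 4 (fun x => p (g x))) w.
have cRe : coordinate (@complex.Re R) by left.
have cIm : coordinate (@complex.Im R) by right.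
pose Gr w := complex.Re (g w); pose Gi w := complex.Im (g w).
have CK p (G := fun x => p (g x)) : Ck 3 G -> continuous (K p).
  move=> CG; apply: (@Ck_continuous _ 0); apply: Ck_radial_density.
  by apply: Ck_radial_density; exact: CkS.
have Ce (G : R * R -> R) : Ck 3 G -> continuous (fun w => euler (euler G) w - euler G w).
  move=> CG; have c1 := Ck_continuous (Ck_euler CG).
  have c2 := Ck_continuous (Ck_euler (Ck_euler CG)).
  by move=> w; apply: cvgB; [exact: c2|exact: c1].
have sq (h : R * R -> R) : continuous h ->
    measurable_fun [set: measurableTypeR R * measurableTypeR R] (fun w => h w ^+ 2).
  by move=> ch; apply: measurable_funX; exact: continuous_plane_measurable.
have msq (h k : R * R -> R) : continuous h -> continuous k ->
    measurable_fun [set: measurableTypeR R * measurableTypeR R]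
      (fun w => (h w ^+ 2 + k w ^+ 2)%:E).
  by move=> ch ck; apply/measurable_EFinP; apply: measurable_funD; exact: sq.
have ge0 (x y : R) : (0 <= (x ^+ 2 + y ^+ 2)%:E :> \bar R)%E.
  by rewrite lee_fin addr_ge0 ?sqr_ge0.
have m1 := msq _ _ (Ck_continuous C1) (Ck_continuous C2).
have m2 := msq _ _ (Ck_continuous (Ck_euler C1)) (Ck_continuous (Ck_euler C2)).
have m3 := msq _ _ (Ce _ C1) (Ce _ C2).
have N1 : (L2norm (r_radial_derive 1 g) ^+ 2 =
    \int[mu2]_w ((euler Gr w) ^+ 2 + (euler Gi w) ^+ 2)%:E)%E.
  rewrite L2norm_sqr; apply: eq_integral => w _.
  by rewrite (coordinate_radial1 _ cRe (CkS (CkS C1))) (coordinate_radial1 _ cIm (CkS (CkS C2))).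
have N2 : (L2norm (r_radial_derive 2 g) ^+ 2 =
    \int[mu2]_w ((euler (euler Gr) w - euler Gr w) ^+ 2 +
      (euler (euler Gi) w - euler Gi w) ^+ 2)%:E)%E.
  rewrite L2norm_sqr; apply: eq_integral => w _.
  by rewrite (coordinate_radial2 _ cRe (CkS C1)) (coordinate_radial2 _ cIm (CkS C2)).
rewrite L2norm_sqr N1 N2.
rewrite -ge0_integralD; [|exact: measurableT| | | |]; last 4 first.
- by move=> w _; rewrite lee_fin sqr_ge0.
- by apply/measurable_EFinP; apply: sq; exact: CK.
- by move=> w _; rewrite lee_fin sqr_ge0.
- by apply/measurable_EFinP; apply: sq; exact: CK.
rewrite -ge0_integralD; [|exact: measurableT| |exact: m1| |exact: m2]; last 2 first.
- by move=> w _; exact: ge0.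
- by move=> w _; exact: ge0.
rewrite -ge0_integralD; [|exact: measurableT| | | |exact: m3]; last 3 first.
- by move=> w _; exact: adde_ge0.
- exact: emeasurable_funD.
- by move=> w _; exact: ge0.
have [k kE] : exists k : R, k = 432 by exists 432.
have k0 : 0 <= k by rewrite kE; exact: ler0n.
rewrite -kE -ge0_integralZl; [|exact: measurableT| | |by rewrite lee_fin]; last 2 first.
- by apply: emeasurable_funD => //; exact: emeasurable_funD.
- by move=> w _; rewrite !adde_ge0.
apply: ge0_le_integral.
- exact: measurableT.
- by move=> w _; rewrite adde_ge0// lee_fin sqr_ge0.
- by apply/measurable_EFinP; apply: measurable_funD; apply: sq; exact: CK.
- by apply: measurable_funeM; apply: emeasurable_funD => //; exact: emeasurable_funD.
move=> w _; rewrite -!EFinD -EFinM lee_fin.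
have kD (x1 x2 y1 y2 z1 z2 : R) : k * (x1 + x2 + (y1 + y2) + (z1 + z2)) =
    k * (x1 + y1 + z1) + k * (x2 + y2 + z2) by ring.
rewrite kD kE; apply: lerD.
- exact: radial_density_sqr_le w (CkS C1).
- exact: radial_density_sqr_le w (CkS C2).
Qed.

End Bounds.

(** * The expected squared error over the sample space *)

Theorem theorem2 (R : realType) :
  exists C : R, 0 < C /\
  forall f : R -> R,
    f \in Lfun (@lebesgue_measure R) 2%:E ->
    complex_Ck 3 (bispectrum f) ->
    (forall k : nat, (k = 2%N \/ k = 3%N) ->
       radial_max k (bispectrum f) \in
         Lfun (@lebesgue_measure R \x @lebesgue_measure R)%E 2%:E) ->
  exists K_f : R,
  forall (eta : R) (M : nat) (d : measure_display) (T : measurableType d)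
    (P : probability T R)
    (t tau : {RV P >-> R}) (ts taus : 'I_M -> {RV P >-> R}),
    0 < eta ->
    eta ^+ 2 <= 12^-1 ->
    (0 < M)%N ->
    uniformly_distributed tau ->
    ('E_P[tau] = 0)%E ->
    ('V_P[tau] = (eta ^+ 2)%:E)%E ->
    independent_samples t ts ->
    independent_samples tau taus ->
    {ae P, forall w, forall j : 'I_M,
       ess_support (observation f (ts j w) (taus j w)) `<=` `[- 2^-1, 2^-1]} ->
    (\int[P]_w (
       L2norm (fun x : R * R => (bispectrum f x -
         bispectrum_estimator eta
           (fun j : 'I_M => observation f (ts j w) (taus j w)) x)%R) ^+ 2)
     <= C%:E * ((eta ^+ 2 / M%:R)%:E * L2norm (bispectrum f) ^+ 2
              + (eta ^+ 2 / M%:R)%:E *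
                  L2norm (r_radial_derive 1 (bispectrum f)) ^+ 2
              + (eta ^+ 2 / M%:R)%:E *
                  L2norm (r_radial_derive 2 (bispectrum f)) ^+ 2)
        + (K_f * (eta ^+ 4 / M%:R))%:E)%E.
Proof.
(* 972 is [3 / 4 * 3 * 432]: the variance factor, [a ^+ 2 = 3 * eta ^+ 2], and the constant of the
   pointwise bound. *)
have [C CE] : exists C : R, C = 972 by exists 972.
exists C; split; first by rewrite CE ltr0n.
move=> f fL2 B3 _; exists 0.
move=> eta M d T P t tau ts taus eta0 eta12 M0 tauU Etau Vtau _ samples supp.
rewrite mul0r adde0.
set a := Num.sqrt 3 * eta.
have a0 : 0 < a by rewrite mulr_gt0// sqrtr_gt0.
have a2 : a ^+ 2 = 3 * eta ^+ 2 by rewrite exprMn sqr_sqrtr.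
(* From [3 * eta ^+ 2 <= 1 / 4]; it keeps every dilation factor [1 - tau] between [1 / 2] and
   [3 / 2]. *)
have a12 : a <= 2^-1.
  have : a ^+ 2 <= (2^-1) ^+ 2 by rewrite a2 expr2; lra.
  by rewrite ler_sqr ?nnegrE// ltW.
have [aa tauE] := uniform_sampleP eta0 tauU Etau Vtau; rewrite -/a in aa tauE.
have tausE j (A : set R) : measurable A -> distribution P (taus j) A = uniform_prob aa A.
  by move=> mA; rewrite samples.2// tauE.
have tau_itv : {ae P, forall w, forall j, - a <= taus j w <= a}.
  apply: filter_forall => j; exact: (uniform_sample_bounded (@tausE j)).
have good : {ae P, forall w, (forall j : 'I_M,
       ess_support (observation f (ts j w) (taus j w)) `<=` `[- 2^-1, 2^-1]) /\
     forall j, - a <= taus j w <= a} by apply: filterS2 supp tau_itv.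
(* A deterministic fact, read off from a single outcome and from the observation of index 0, which
   exists because [M] is positive. *)
have fi : (@lebesgue_measure R).-integrable setT (EFin \o f).
  have [w [suppw tauw]] := ae_nonempty good.
  pose j0 := Ordinal M0; apply: (observation_integrable _ fL2 (suppw j0)).
  by have /andP[_] := tauw j0; move: a12; lra.
pose G p := fun w : R * R => p (bispectrum f w) : R.
pose V p w x := sample_deviation a taus (G p) w x.
pose Re := @complex.Re R; pose Im := @complex.Im R.
have cRe : coordinate Re by left.
have cIm : coordinate Im by right.
pose W w := ((\int[lebesgue_measure \x lebesgue_measure]_x ((V Re w x) ^+ 2)%:E) +
  (\int[lebesgue_measure \x lebesgue_measure]_x ((V Im w x) ^+ 2)%:E))%E.
have CG p : coordinate p -> Ck 3 (G p) by exact: Ck_coordinate.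
have mW p : coordinate p -> measurable_fun setT
    (fun w => \int[lebesgue_measure \x lebesgue_measure]_x ((V p w x) ^+ 2)%:E)%E.
  by move=> cp; exact: measurable_sample_deviation_L2 (CkS (CG p cp)).
have V0 p w : (0 <= \int[lebesgue_measure \x lebesgue_measure]_x ((V p w x) ^+ 2)%:E)%E.
  by apply: integral_ge0 => x _; rewrite lee_fin sqr_ge0.
(* [W] is measurable and dominates the squared error at every outcome where supports and dilations
   are as assumed, that is, almost surely. *)
apply: (@le_trans _ _ (\int[P]_w W w)%E).
  apply: ge0_le_integral_majorant.
  - by move=> w; exact: L2norm_sqr_ge0.
  - by move=> w; rewrite adde_ge0.
  - by apply: emeasurable_funD; exact: mW.
  apply: filterS good => w [_ tauw].
  rewrite L2norm_sqr.
  have [mr Er] := coordinate_estimator_error (fun j => ts j w) eta0 a12 B3 fi tauw cRe.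
  have [mi Ei] := coordinate_estimator_error (fun j => ts j w) eta0 a12 B3 fi tauw cIm.
  under eq_integral do rewrite EFinD.
  rewrite ge0_integralD//; last 4 first.
  - by move=> x _; rewrite lee_fin sqr_ge0.
  - by apply/measurable_EFinP; exact: measurable_funX.
  - by move=> x _; rewrite lee_fin sqr_ge0.
  - by apply/measurable_EFinP; exact: measurable_funX.
  exact: leeD Er Ei.
rewrite ge0_integralD; [|exact: measurableT|by move=> w _; exact: V0|exact: mW
  |by move=> w _; exact: V0|exact: mW].
have L2 p (cp : coordinate p) := sample_deviation_L2 a0 a12 M0 (CkS (CG p cp)) tauE samples.
apply: le_trans (leeD (L2 _ cRe) (L2 _ cIm)) _.
rewrite -ge0_muleDr; last 2 first.
- by apply: integral_ge0 => x _; rewrite lee_fin sqr_ge0.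
- by apply: integral_ge0 => x _; rewrite lee_fin sqr_ge0.
have Mi0 : 0 <= eta ^+ 2 / M%:R by rewrite divr_ge0// sqr_ge0.
have k0 : 0 <= 3 / 4 * a ^+ 2 / M%:R by rewrite divr_ge0// mulr_ge0// sqr_ge0.
apply: le_trans (lee_wpmul2l _ (radial_density_L2_le B3)) _; first by rewrite lee_fin.
have L0 := @L2norm_sqr_ge0 R.
rewrite -!ge0_muleDr ?adde_ge0// muleA -EFinM [leRHS]muleA -EFinM.
rewrite lee_wpmul2r ?adde_ge0// lee_fin a2 CE.
rewrite le_eqVlt; apply/orP; left; apply/eqP; field.
by rewrite pnatr_eq0 -lt0n.
Qed.
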